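(* Consider the residual surplus objective. For every $\rho>1$ there is a sufficiently large $n$ such that, in the $n$-agent, $1$-unit setting, no mixture over standard auctions is universally adopted with competitive advantage $\rho$; that is, for every mechanism $M$ that is a probability mixture of standard auctions, it is not the case that $M(\mathbf v)\ge\tfrac1\rho\,\mathcal G(\mathbf v)$ for all valuation profiles $\mathbf v\in[0,\infty)^n$.
   Context: One item, $n$ agents with values $\mathbf v\in[0,\infty)^n$. A mechanism has allocation probabilities $x_i(\mathbf v)\in[0,1]$, $\sum_i x_i(\mathbf v)\le 1$, non-decreasing in the agent's own value, and expected payments $p_i(\mathbf v)=v_ix_i(\mathbf v)-\int_0^{v_i}x_i(z,\mathbf v_{-i})\,dz$; its expected residual surplus is $M(\mathbf v)=\sum_i(v_ix_i(\mathbf v)-p_i(\mathbf v))$. The residual surplus of a mixture is the corresponding average of the residual surpluses. Standard auction. A standard auction is a symmetric residual-surplus-optimal mechanism $\mathrm{Opt}_F$ for some continuous distribution $F$ (density $f$) on the nonnegative reals, i.e. an ironed virtual surplus maximizer: let $\vartheta(v)=\frac{1-F(v)}{f(v)}$, $h(q)=\vartheta(F^{-1}(q))$ for $q\in[0,1]$, $H(q)=\int_0^qh(r)\,dr$, $\check H$ the largest convex function on $[0,1]$ bounded above by $H$, $g$ the derivative of $\check H$ (extended by right-continuity), $\bar\vartheta(z)=g(F(z))$ (non-decreasing). $\mathrm{Opt}_F$ gives the item to an agent with the highest ironed virtual value $\bar\vartheta(v_i)$, ties broken uniformly at random. (Within regions where $\bar\vartheta$ is constant the tie-breaking is random, otherwise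 the higher value wins; the Vickrey auction and the uniform lottery are examples.) Benchmark. $\mathcal G(\mathbf v)=\sup_F\mathrm{Opt}_F(\mathbf v)$, the supremum over all continuous distributions $F$ of the expected residual surplus of $\mathrm{Opt}_F$ on $\mathbf v$. *)

(* Defs.v *)
From HB Require Import structures.
From mathcomp Require Import all_boot all_order all_algebra.
From mathcomp Require Import all_classical all_reals all_analysis.

Set Implicit Arguments.
Unset Strict Implicit.
Unset Printing Implicit Defensive.

Import Order.TTheory GRing.Theory Num.Theory.
Import numFieldNormedType.Exports.

Local Open Scope classical_set_scope.
Local Open Scope ring_scope.

(* [alloc i v] is the probability that agent [i] receives the item when the
   valuation profile is [v]. *)
Definition allocation_rule (R : realType) (n : nat) : Type :=
  'I_n -> ('I_n -> R) -> R.

Section mechanisms.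
Context {R : realType} {n : nat}.
Implicit Types (x : allocation_rule R n) (v : 'I_n -> R) (i : 'I_n).
Local Notation mu := (@lebesgue_measure R).

Definition profile v : Prop := forall i, 0 <= v i.

(* [[eta v with i |-> z]] is the profile (z, v_{-i}). *)
Definition payment x i v : R :=
  v i * x i v - \int[mu]_(z in `[0, v i]) x i [eta v with i |-> z].

Definition residual_surplus x v : R :=
  \sum_(i < n) (v i * x i v - payment x i v).

End mechanisms.

(* A continuous distribution on the nonnegative reals, given by its density;
   the values of [density] at negative arguments are never used. *)
Record cont_dist (R : realType) := ContDist {
  density : R -> R ;
  density_measurable : measurable_fun (`[0, +oo[%classic : set R) density ;
  density_ge0 : forall t : R, 0 <= t -> 0 <= density t ;
  density_total :
    (\int[@lebesgue_measure R]_(t in `[0%R, +oo[) (density t)%:E = 1)%E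
}.

(* The largest convex function on [0, 1] lying below [H], as the pointwise
   supremum of the convex minorants (see [convex_hull_below_le],
   [convex_hull_below_convex] and [convex_hull_below_largest]). Values are
   extended reals because H(1) can be infinite when F has infinite mean. *)
Definition convex_minorant (R : realType) (H : R -> \bar R) (phi : R -> R) :=
  convex_function (E := R^o) `[0, 1]%classic phi /\
  (forall q : R, 0 <= q <= 1 -> ((phi q)%:E <= H q)%E).

Definition convex_hull_below (R : realType) (H : R -> \bar R) (q : R) : \bar R :=
  ereal_sup [set (phi q)%:E | phi in convex_minorant H].

Lemma convex_hull_below_le (R : realType) (H : R -> \bar R) (q : R) :
  0 <= q <= 1 -> (convex_hull_below H q <= H q)%E.
Proof. by move=> q01; apply: ge_ereal_sup => _ [phi [_ phiH] <-]; exact: phiH. Qed.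

Lemma convex_hull_below_largest (R : realType) (H : R -> \bar R) (phi : R -> R)
    (q : R) : convex_minorant H phi -> ((phi q)%:E <= convex_hull_below H q)%E.
Proof. by move=> Hphi; apply: ereal_sup_ubound; exists phi. Qed.

Lemma convex_hull_below_convex (R : realType) (H : R -> \bar R) (p q t : R) :
  0 <= p <= 1 -> 0 <= q <= 1 -> 0 <= t <= 1 ->
  (convex_hull_below H (t * p + (1 - t) * q)%R <=
   t%:E * convex_hull_below H p + (1 - t)%:E * convex_hull_below H q)%E.
Proof.
move=> p01 q01 /andP[t0 t1]; apply: ge_ereal_sup => _ [phi phiH <-].
have t01 : Itv.spec (@Itv.num_sem R) (Itv.Real `[0%Z, 1%Z]) t.
  by rewrite /= /Itv.num_sem /= ger0_real //= in_itv /= t0 t1.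
have := phiH.1 (Itv.mk t01) p q.
rewrite !inE /= !in_itv /= => /(_ p01 q01) cvx.
apply: (@le_trans _ _ ((t * phi p + (1 - t) * phi q)%:E)).
  by rewrite lee_fin; exact: cvx.
rewrite EFinD !EFinM; apply: leeD; apply: lee_wpmul2l;
  by rewrite ?lee_fin ?subr_ge0 //; exact: convex_hull_below_largest.
Qed.

(* The derivative of a convex function [G] on [0, 1] wherever it exists in the
   interior, extended by right-continuity to the other points of [0, 1[. At 1,
   where there is no point to the right, it is extended by its left limit.
   Limits are taken in the extended reals, where monotone functions converge. *)
Definition rc_derivative (R : realType) (G : R -> R) (q : R) : \bar R :=
  let D := [set r : R | 0 < r < 1 /\ derivable G r 1] in
  if q \in D then (derive1 G q : R)%:E
  else if q < 1 then lim ((derive1 G r : R)%:E @[r --> within D q^'+])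
  else lim ((derive1 G r : R)%:E @[r --> within D q^'-]).

Section ironing.
Context {R : realType}.
Variable F : cont_dist R.
Local Notation mu := (@lebesgue_measure R).

Definition cdf_of (t : R) : R := \int[mu]_(s in `[0, t]) density F s.

(* Generalized inverse, since F may be flat or never reach 1; the integral
   [H_fun] only involves its values on ]0, 1[. *)
Definition quantile (q : R) : R := inf [set t : R | 0 <= t /\ q <= cdf_of t].

(* Where the density vanishes the quotient is 0; such points are met by [quantile] on
   a set of measure zero only, hence do not affect [H_fun]. *)
Definition virtual_value (t : R) : R := (1 - cdf_of t) / density F t.

Definition h_fun (q : R) : R := virtual_value (quantile q).

Definition H_fun (q : R) : \bar R := (\int[mu]_(r in `[0%R, q]) (h_fun r)%:E)%E.

Definition g_fun : R -> \bar R :=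
  rc_derivative (fine \o convex_hull_below H_fun).

Definition ironed_virtual_value (t : R) : \bar R := g_fun (cdf_of t).

Definition winners n (v : 'I_n -> R) : {set 'I_n} :=
  [set i | [forall j, (ironed_virtual_value (v j) <=
                       ironed_virtual_value (v i))%E]].

Definition Opt n : allocation_rule R n := fun i v =>
  if i \in winners v then (#|winners v|%:R)^-1 else 0.

End ironing.
Arguments Opt {R} F n.

(* Probability mixture of standard auctions: a random distribution [mix_dist]
   is drawn, and the standard auction for it is run. *)
Record auction_mixture (R : realType) (n : nat) := AuctionMixture {
  mix_disp : measure_display ;
  mix_space : measurableType mix_disp ;
  mix_prob : probability mix_space R ;
  mix_dist : mix_space -> cont_dist R ;
  mix_measurable : forall v : 'I_n -> R, profile v ->
    measurable_fun setT (fun w => residual_surplus (Opt (mix_dist w) n) v)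
}.

Definition mixture_surplus (R : realType) (n : nat) (M : auction_mixture R n)
    (v : 'I_n -> R) : \bar R :=
  (\int[mix_prob M]_w (residual_surplus (Opt (mix_dist w) n) v)%:E)%E.

Definition benchmark (R : realType) (n : nat) (v : 'I_n -> R) : \bar R :=
  ereal_sup [set (residual_surplus (Opt F n) v)%:E | F in [set: cont_dist R]].

Definition universally_adopted (R : realType) (n : nat) (rho : R)
    (M : auction_mixture R n) : Prop :=
  forall v : 'I_n -> R, profile v ->
    ((rho^-1)%:E * benchmark v <= mixture_surplus M v)%E.

(* Main.v *)
From HB Require Import structures.
Require Import Defs.
From mathcomp Require Import all_boot all_order all_algebra.
From mathcomp Require Import all_classical all_reals all_analysis.
From mathcomp Require Import measurable_realfun zify ring lra.

(* The ironed virtual value [theta] of any distribution is nondecreasing. Hence,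
   if the top value 1 is held by at least two agents, a standard auction is a
   lottery among the agents whose value lies above a threshold b, namely the
   bottom of the ironed interval containing 1, and its residual surplus is the
   average of v_i - b over these agents.
   Take values on the grid 1 - j / N^2, with a number of agents growing so fast
   with j that any threshold yields a surplus of order 1 / N^2 only, since almost
   all the winners sit just above it. Moving the agents of one block of N
   consecutive levels down to the bottom of the block opens a gap of width 1 / N:
   a threshold inside this gap yields a surplus of order 1 / N, and no other
   threshold does. There are N disjoint gaps, so a mixture puts its threshold in
   the right one with probability 1 / N on average, and it is beaten by the
   benchmark by a factor of order N. *)

Set Implicit Arguments.
Unset Strict Implicit.
Unset Printing Implicit Defensive.

Import Order.TTheory GRing.Theory Num.Theory.
Import numFieldNormedType.Exports.

Local Open Scope classical_set_scope.
Local Open Scope ring_scope.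

(** * Derivatives of convex functions *)

Section convex_on_unit_interval.
Context {R : realType} (G : R -> R).

(** The endpoints are left out because the convex hull of H can be infinite at 1, where [fine]
    replaces it by 0 and may destroy convexity. *)
Definition convex01 : Prop := forall p q t : R,
  0 < p < 1 -> 0 < q < 1 -> 0 <= t <= 1 ->
  G (t * p + (1 - t) * q) <= t * G p + (1 - t) * G q.

Hypothesis Gcvx : convex01.

Let shiftE (x h : R) : (G \o shift x) h%:A = G (x + h).
Proof. by rewrite /= [h%:A]mulr1 addrC. Qed.

(** The chord inequality with denominators cleared, so that it covers degenerate triples and stays
    linear in the values of [G]. *)
Lemma convex01_three_points (x y z : R) : 0 < x -> x <= y -> y <= z -> z < 1 ->
  (z - x) * G y <= (z - y) * G x + (y - x) * G z.
Proof.
move=> x0 xy yz z1; have [xz|xz] := ltP x z; last first.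
  have -> : y = x by lra.
  have -> : z = x by lra.
  by rewrite subrr !mul0r addr0.
have zx0 : 0 < z - x by rewrite subr_gt0.
have zx : z - x != 0 by rewrite gt_eqF.
have xP : 0 < x < 1 by rewrite x0 (lt_trans xz).
have zP : 0 < z < 1 by rewrite z1 (lt_trans x0).
have tP : 0 <= (z - y) / (z - x) <= 1.
  by apply/andP; split; [rewrite divr_ge0; lra|rewrite ler_pdivrMr//; lra].
have := Gcvx xP zP tP.
have -> : (z - y) / (z - x) * x + (1 - (z - y) / (z - x)) * z = y by field.
rewrite -(ler_pM2l zx0) => /le_trans; apply.
by rewrite le_eqVlt; apply/orP; left; apply/eqP; field.
Qed.

(** Chords from [x] to [x - d] and [x + d] bound the increments of [G] above by a multiple of [|h|].
    As [x] is the midpoint of [x - h] and [x + h], the upper bound at [- h] is a lower bound at [h],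
    so [G] satisfies a Lipschitz bound at [x]. *)
Lemma convex01_continuous (x : R) : 0 < x < 1 -> {for x, continuous G}.
Proof.
move=> /andP[x0 x1].
have [d [d0 dx dx1]] : exists d : R, [/\ 0 < d, 0 < x - d & x + d < 1].
  exists (Num.min (x / 2) ((1 - x) / 2)); split.
  - by rewrite lt_min; apply/andP; split; lra.
  - by rewrite subr_gt0 gt_min; apply/orP; left; lra.
  - by rewrite -ltrBrDl gt_min; apply/orP; right; lra.
pose C := `|G (x - d) - G x| + `|G (x + d) - G x|.
have up h : - d <= h <= d -> d * (G (x + h) - G x) <= `|h| * C.
  move=> /andP[dh hd].
  have [h0|h0] := leP 0 h.
  - have := @convex01_three_points x (x + h) (x + d) x0.
    have -> : x + d - x = d by ring.
    have -> : x + h - x = h by ring.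
    have -> : x + d - (x + h) = d - h by ring.
    have /(ler_wpM2l h0) : G (x + d) - G x <= C.
      by rewrite /C (le_trans (ler_norm _))// lerDr.
    move=> H1 /(_ _ _ _)H2; have {H2} := H2 ltac:(lra) ltac:(lra) dx1.
    rewrite ger0_norm//.
    by lra.
  - have := @convex01_three_points (x - d) (x + h) x dx.
    have -> : x - (x - d) = d by ring.
    have -> : x + h - (x - d) = d + h by ring.
    have -> : x - (x + h) = - h by ring.
    have h0' : 0 <= - h by lra.
    have /(ler_wpM2l h0') : G (x - d) - G x <= C.
      by rewrite /C (le_trans (ler_norm _))// lerDl.
    move=> H1 /(_ _ _ _)H2; have {H2} := H2 ltac:(lra) ltac:(lra) x1.
    rewrite ltr0_norm//.
    by lra.
have lip h : - d <= h <= d -> `|G (x + h) - G x| <= `|h| * (C / d).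
  move=> hd; rewrite mulrA ler_pdivlMr// mulrC.
  have [Gh|Gh] := leP 0 (G (x + h) - G x).
    by rewrite ger0_norm//; exact: up.
  have hd' : - d <= - h <= d by clear -hd; lra.
  have := up _ hd'; rewrite normrN; apply: le_trans.
  rewrite ltr0_norm// ler_pM2l//.
  have := @Gcvx (x + h) (x - h) (1 / 2); clear - dx dx1 hd.
  move=> /(_ ltac:(lra) ltac:(lra) ltac:(lra)).
  have -> : 1 / 2 * (x + h) + (1 - 1 / 2) * (x - h) = x by field.
  by lra.
have C1 : 0 < C / d + 1 by rewrite ltr_wpDl// divr_ge0 ?(ltW d0)// addr_ge0.
apply/cvgrPdist_le => e e0; near=> y.
rewrite distrC; have -> : y = x + (y - x) by ring.
have yd : `|x - y| <= Num.min d (e / (C / d + 1)).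
  near: y; apply: cvgr_dist_le => //.
    by rewrite lt_min d0 divr_gt0.
have : - d <= y - x <= d.
  by rewrite -ler_norml distrC; move: yd; rewrite le_min => /andP[].
move/lip => /le_trans; apply.
apply: (@le_trans _ _ (`|x - y| * (C / d + 1))).
  by rewrite distrC ler_wpM2l// lerDl.
by rewrite -ler_pdivlMr//; move: yd; rewrite le_min => /andP[].
Unshelve. all: by end_near. Qed.

(** After subtracting a steep parabola, [G] has an interior maximum [c] on [[a, b]]. There a
    parabola touches [G] from above, which together with convexity forces a derivative. *)
Lemma convex01_derivable_dense (a b : R) : 0 < a -> a < b -> b < 1 ->
  exists r, [/\ a < r, r < b & derivable G r 1].
Proof.
move=> a0 ab b1.
pose m := (a + b) / 2; pose d := (b - a) / 2.
have d0 : 0 < d by rewrite /d; lra.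
(* With this [K], the function [G - Phi] is smaller at [a] and [b] than at the midpoint [m], which
   keeps the maximum away from the ends. *)
pose K := (`|G a - G m| + `|G b - G m| + 1) / d ^+ 2.
pose Phi x := K * (x - m) ^+ 2.
have Kd : K * d ^+ 2 = `|G a - G m| + `|G b - G m| + 1.
  by rewrite divfK// expf_neq0// gt_eqF.
have cont : {within `[a, b], continuous (G \- Phi)}.
  apply: continuous_in_subspaceT => x; rewrite inE/= in_itv/= => /andP[ax xb].
  have x01 : 0 < x < 1 by lra.
  apply: continuousB; first exact: convex01_continuous.
  apply: (@continuousM _ _ (cst K) (fun x => (x - m) ^+ 2)).
    exact: cst_continuous.
  apply: (@continuous_comp _ _ _ (fun x : R => x - m) (fun x => x ^+ 2)).
    by apply: continuousB; [exact: id | exact: cst_continuous].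
  exact: exprn_continuous.
have [c] := EVT_max (ltW ab) cont.
rewrite in_itv/= => /andP[ac cb] cmax.
have mP : m \in `[a, b] by rewrite in_itv/= /m; apply/andP; split; lra.
have := cmax _ mP; rewrite /= /Phi subrr expr0n/= mulr0 subr0 => mc.
have am : (a - m) ^+ 2 = d ^+ 2 by rewrite /m /d; field.
have bm : (b - m) ^+ 2 = d ^+ 2 by rewrite /m /d; field.
have Ga := ler_norm (G a - G m); have Gb := ler_norm (G b - G m).
have Ga0 := normr_ge0 (G a - G m); have Gb0 := normr_ge0 (G b - G m).
have {}ac : a < c.
  rewrite lt_neqAle ac andbT; apply/eqP => ca; subst c.
  by move: mc; rewrite am Kd; lra.
have {}cb : c < b.
  rewrite lt_neqAle cb andbT; apply/eqP => bc; subst c.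
  by move: mc; rewrite bm Kd; lra.
exists c; split => //.
pose s := 2 * K * (c - m).
have K0 : 0 <= K by rewrite /K divr_ge0 ?sqr_ge0//; lra.
(* The parabola touches [G] from above at [c], and convexity turns this upper
   bound at [c - h] into a lower bound at [c + h]. *)
have quad h : a <= c - h <= b -> a <= c + h <= b ->
    `|G (c + h) - G c - s * h| <= K * h ^+ 2.
  move=> h1 h2.
  have up k : a <= c + k <= b -> G (c + k) - G c - s * k <= K * k ^+ 2.
    move=> ck; have := cmax (c + k); rewrite in_itv/= => /(_ ck).
    rewrite /Phi /s => H.
    have -> : K * k ^+ 2 = K * (c + k - m) ^+ 2 - K * (c - m) ^+ 2
      - 2 * K * (c - m) * k by ring.
    by lra.
  have u1 := up _ h2; have := up _ h1; rewrite sqrrN => u2.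
  have := @Gcvx (c + h) (c - h) (1 / 2); clear - h1 h2 u1 u2 a0 b1.
  move=> /(_ ltac:(lra) ltac:(lra) ltac:(lra)).
  have -> : 1 / 2 * (c + h) + (1 - 1 / 2) * (c - h) = c by field.
  by move=> u3; rewrite ler_norml; apply/andP; split; lra.
apply: (@cvgP _ _ (s : R)).
apply/cvgrPdist_le => e e0; near=> h.
have h0 : h != 0 by near: h; exact: nbhs_dnbhs_neq.
have hsmall : `|h| <= Num.min (e / (K + 1)) (Num.min (c - a) (b - c)).
  near: h; apply: dnbhs0_le.
  by rewrite !lt_min !subr_gt0 ac cb divr_gt0//; lra.
move: hsmall; rewrite !le_min => /and3P[he].
rewrite [in X in X -> _]ler_norml => /andP[h1 h2].
rewrite [in X in X -> _]ler_norml => /andP[h3 h4].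
have hc1 : a <= c - h <= b by clear -h1 h2 h3 h4; lra.
have hc2 : a <= c + h <= b by clear -h1 h2 h3 h4; lra.
have := quad h hc1 hc2; rewrite shiftE distrC.
have -> : s - h^-1 *: (G (c + h) - G c) = h^-1 * (s * h - (G (c + h) - G c)).
  by rewrite [RHS]mulrBr [X in _ = X - _]mulrC mulfK.
rewrite normrM normfV => H.
rewrite ler_pdivrMl ?normr_gt0//; apply: (le_trans H).
rewrite -real_normK ?num_real// expr2 mulrCA ler_wpM2l//.
rewrite (@le_trans _ _ ((K + 1) * `|h|))//; first by rewrite ler_wpM2r ?lerDl.
by rewrite mulrC -ler_pdivlMr//; lra.
Unshelve. all: by end_near. Qed.

(** The difference quotient from [x] to [x + h] is at most the slope of the chord over [[x, y]], and
    the bound survives the limit from the right. *)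
Lemma convex01_derive1_le_slope (x y : R) : 0 < x -> x < y -> y < 1 ->
  derivable G x 1 -> G^`()%classic x * (y - x) <= G y - G x.
Proof.
move=> x0 xy y1 dG.
have yx0 : 0 < y - x by rewrite subr_gt0.
rewrite -ler_pdivlMr// derive1E.
have /cvg_dnbhs_at_right cG := dG.
apply: (@closed_cvg _ _ _ _ _ (fun z => z <= (G y - G x) / (y - x)) _ _ _ cG).
  exact: closed_le.
near=> h.
have h0 : 0 < h by near: h; exact: nbhs_right_gt.
have hyx : h < y - x by near: h; exact: nbhs_right_lt.
have := @convex01_three_points x (x + h) y x0 ltac:(lra) ltac:(lra) y1.
rewrite shiftE => H.
rewrite ler_pdivlMr// -[X in X <= _]/(h^-1 * _ * _) -mulrA ler_pdivrMl//.
by move: H; lra.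
Unshelve. all: by end_near. Qed.

Lemma convex01_slope_le_derive1 (x y : R) : 0 < x -> x < y -> y < 1 ->
  derivable G y 1 -> G y - G x <= G^`()%classic y * (y - x).
Proof.
move=> x0 xy y1 dG.
have yx0 : 0 < y - x by rewrite subr_gt0.
rewrite -ler_pdivrMr// derive1E.
have /cvg_dnbhs_at_left cG := dG.
apply: (@closed_cvg _ _ _ _ _ (fun z => (G y - G x) / (y - x) <= z) _ _ _ cG).
  exact: closed_ge.
near=> h.
have h0 : h < 0 by near: h; exact: nbhs_left_lt.
have hyx : x - y < h by near: h; apply: nbhs_left_gt; rewrite subr_lt0.
have := @convex01_three_points x (y + h) y x0 ltac:(lra) ltac:(lra) y1.
rewrite shiftE => H.
rewrite ler_pdivrMr// -[X in _ <= X]/(h^-1 * _ * _) -mulrA -[h]opprK invrN.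
rewrite mulNr -mulrN ler_pdivlMl ?oppr_gt0// opprK.
by move: H; lra.
Unshelve. all: by end_near. Qed.

Lemma convex01_derive1_le (x y : R) : 0 < x -> x < y -> y < 1 ->
  derivable G x 1 -> derivable G y 1 -> G^`()%classic x <= G^`()%classic y.
Proof.
move=> x0 xy y1 dx dy; have yx0 : 0 < y - x by rewrite subr_gt0.
rewrite -(ler_pM2r yx0); apply: (@le_trans _ _ (G y - G x)).
  exact: convex01_derive1_le_slope.
exact: convex01_slope_le_derive1.
Qed.

(** * One-sided limits of the derivative *)

Let D := [set r : R | 0 < r < 1 /\ derivable G r 1].

(** Density of [D] makes the restricted filter proper, so that limits along it are unique and [lim]
    can be computed. *)
Let right_proper (q : R) : 0 <= q < 1 -> ProperFilter (within D q^'+).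
Proof.
move=> /andP[q0 q1]; apply: Build_ProperFilter_ex => P [e /= e0 He].
have m0 : 0 < Num.min e (1 - q) by rewrite lt_min e0 subr_gt0.
have m1 : Num.min e (1 - q) <= 1 - q by rewrite ge_min lexx orbT.
have m2 : Num.min e (1 - q) <= e by rewrite ge_min lexx.
have [r [r1 r2 dr]] := @convex01_derivable_dense
  (q + Num.min e (1 - q) / 3) (q + Num.min e (1 - q) / 2)
  ltac:(lra) ltac:(lra) ltac:(lra).
exists r; apply: He => /=; last by split => //; apply/andP; split; lra.
- by rewrite ltr_norml; apply/andP; split; lra.
- lra.
Qed.

Let left_proper (q : R) : 0 < q <= 1 -> ProperFilter (within D q^'-).
Proof.
move=> /andP[q0 q1]; apply: Build_ProperFilter_ex => P [e /= e0 He].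
have m0 : 0 < Num.min e q by rewrite lt_min e0.
have m1 : Num.min e q <= q by rewrite ge_min lexx orbT.
have m2 : Num.min e q <= e by rewrite ge_min lexx.
have [r [r1 r2 dr]] := @convex01_derivable_dense
  (q - Num.min e q / 2) (q - Num.min e q / 3)
  ltac:(lra) ltac:(lra) ltac:(lra).
exists r; apply: He => /=; last by split => //; apply/andP; split; lra.
- by rewrite ltr_norml; apply/andP; split; lra.
- lra.
Qed.

Let d (x : R) : \bar R := (G^`()%classic x)%:E.

(** A nondecreasing extension of the derivative from [D] to all reals: convergence of monotone
    functions applies to it, and restricting the filter to [D] gives back the derivative. *)
Let dbar (x : R) : \bar R := ereal_inf (d @` [set r | D r /\ x <= r]).

Let dbarE (x : R) : D x -> dbar x = d x.
Proof.
move=> [/andP[x0 x1] dx]; apply/eqP; rewrite eq_le; apply/andP; split.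
  by apply: ereal_inf_lbound; exists x => //; split => //; split=> //; rewrite x0.
apply: le_ereal_inf_tmp => _ [r [[/andP[r0 r1] dr] xr] <-].
rewrite lee_fin; move: xr; rewrite le_eqVlt => /predU1P[->//|xr].
exact: convex01_derive1_le.
Qed.

Let dbar_nd : {homo dbar : x y / x <= y >-> (x <= y)%E}.
Proof.
move=> x y xy; apply: ereal_inf_le_tmp => _ [r [Dr yr] <-].
by exists r => //; split=> //; exact: le_trans yr.
Qed.

Let le_dbar (r x : R) : D r -> r <= x -> (d r <= dbar x)%E.
Proof. by move=> Dr rx; rewrite -dbarE//; exact: dbar_nd. Qed.

Let dbar_le (r x : R) : D r -> x <= r -> (dbar x <= d r)%E.
Proof. by move=> Dr rx; rewrite -dbarE//; exact: dbar_nd. Qed.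

Let lim_right (q : R) : 0 <= q < 1 ->
  lim (d x @[x --> within D q^'+]) = ereal_inf (dbar @` `]q, 1[%classic).
Proof.
move=> q01; have PF := right_proper q01; apply/cvg_lim => //.
have qlt1 : (BRight q < BLeft (1 : R))%O by move: q01 => /andP[_]; rewrite bnd_simp.
have := @nondecreasing_at_right_cvge _ dbar q (BLeft 1) qlt1.
move=> /(_ (fun x y _ _ => @dbar_nd x y)).
move/(cvg_within_filter D); apply: cvg_trans.
apply: near_eq_cvg; rewrite near_withinE; near=> x => Dx.
by rewrite dbarE.
Unshelve. all: by end_near. Qed.

(** The left limit at 1 is read as a right limit at -1 of the reflected function. *)
Let lim_left : lim (d x @[x --> within D 1^'-]) =
  ereal_sup ((dbar \o -%R) @` `]-1, 0[%classic).
Proof.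
have PF : ProperFilter (within D 1^'-) by apply: left_proper; rewrite ltr01/=.
apply/cvg_lim => //.
have lt01 : (BRight (-1 : R) < BLeft (0 : R))%O by rewrite bnd_simp; lra.
have nd x y : x <= y -> (dbar (- y) <= dbar (- x))%E.
  by move=> xy; apply: dbar_nd; rewrite lerN2.
have := @nonincreasing_at_right_cvge _ (dbar \o -%R) (-1) (BLeft 0) lt01.
move=> /(_ (fun x y _ _ => nd x y)).
rewrite -cvg_at_leftNP => /(cvg_within_filter D); apply: cvg_trans.
apply: near_eq_cvg; rewrite near_withinE; near=> x => Dx.
by rewrite dbarE.
Unshelve. all: by end_near. Qed.

Lemma rc_derivative_le (q r : R) : 0 <= q -> q < r -> r < 1 ->
  derivable G r 1 -> (rc_derivative G q <= (G^`()%classic r)%:E)%E.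
Proof.
move=> q0 qr r1 dr; have q1 := lt_trans qr r1.
have Dr : D r by split => //; rewrite r1 (le_lt_trans q0).
rewrite /rc_derivative -/D; case: ifPn => [/set_mem[/andP[q0' _] dq]|_].
  by rewrite lee_fin; exact: convex01_derive1_le.
rewrite q1 lim_right ?q0//; apply: (@le_trans _ _ (dbar r)).
  by apply: ereal_inf_lbound; exists r => //=; rewrite in_itv/= qr.
exact: dbar_le.
Qed.

Lemma le_rc_derivative (r q : R) : 0 < r -> r < q -> q <= 1 ->
  derivable G r 1 -> ((G^`()%classic r)%:E <= rc_derivative G q)%E.
Proof.
move=> r0 rq q1 dr; have r1 := lt_le_trans rq q1.
have Dr : D r by split => //; rewrite r0.
rewrite /rc_derivative -/D; case: ifPn => [/set_mem[/andP[_ q1'] dq]|_].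
  by rewrite lee_fin; exact: convex01_derive1_le.
case: ifPn => [q1'|q1'].
  rewrite lim_right ?q1' ?andbT ?(ltW (lt_trans r0 rq))//.
  apply: le_ereal_inf_tmp => _ [x /= + <-]; rewrite in_itv/= => /andP[qx _].
  by apply: le_dbar => //; rewrite (ltW (lt_trans rq qx)).
have q1E : q = 1 by apply/eqP; rewrite eq_le q1 leNgt.
rewrite [in X in (_ <= X)%E]q1E lim_left; apply: (@le_trans _ _ (dbar r)); first exact: le_dbar.
apply: ereal_sup_ubound; exists (- r); last by rewrite /= opprK.
by rewrite /= in_itv/= oppr_lt0 r0 ltrN2 r1.
Qed.

(** A point of differentiability strictly between [p] and [q] separates the two values, whichever
    branches of [rc_derivative] define them. *)
Lemma rc_derivative_nondecreasing (p q : R) : 0 <= p -> p <= q -> q <= 1 ->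
  (rc_derivative G p <= rc_derivative G q)%E.
Proof.
move=> p0; rewrite le_eqVlt => /predU1P[->//|pq] q1.
have [r [pr rq dr]] := @convex01_derivable_dense
  ((2 * p + q) / 3) ((p + 2 * q) / 3) ltac:(lra) ltac:(lra) ltac:(lra).
apply: (@le_trans _ _ (G^`()%classic r)%:E).
  by apply: rc_derivative_le => //; lra.
by apply: le_rc_derivative => //; lra.
Qed.

End convex_on_unit_interval.

(** * Monotonicity of the ironed virtual value *)

(** Inversion is continuous away from 0, and its value at 0 is the constant 0. *)
Lemma measurable_invr (R : realType) :
  measurable_fun [set: R] (GRing.inv : R -> R).
Proof.
have -> : (GRing.inv : R -> R) = (fun x => if x == 0 then 0 else x^-1).
  by apply/funext => x; case: eqVneq => [->|//]; rewrite invr0.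
apply: measurable_fun_if => //.
  exact: measurable_fun_eqr.
rewrite setTI; set D := (X in measurable_fun X _).
have DE : D = [set x : R | x != 0].
  by apply/seteqP; split => x /=; rewrite /D/=; case: eqP.
rewrite DE; apply: open_continuous_measurable_fun; first exact: open_neq.
by move=> x; rewrite inE/= => x0; exact: inv_continuous.
Qed.

(** * The probability law of a density and its cdf *)

Section law.
Context {R : realType} (F : cont_dist R).
Local Notation mu := (@lebesgue_measure R).

Let f0 : R -> \bar R := (EFin \o density F) \_ `[0%R, +oo[.

Let mf0 : measurable_fun setT f0.
Proof.
apply/(measurable_restrictT _ _).1 => //; apply/measurable_EFinP.
exact: density_measurable.
Qed.

Let f0_ge0 (t : R) : (0 <= f0 t)%E.
Proof.
by apply: erestrict_ge0 => x/=; rewrite in_itv/= andbT lee_fin; exact: density_ge0.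
Qed.

Definition law (A : set (measurableTypeR R)) : \bar R :=
  (\int[mu]_(t in A) f0 t)%E.

Let law0 : law set0 = 0%E.
Proof. by rewrite /law integral_set0. Qed.

Let law_ge0 A : (0 <= law A)%E.
Proof. exact: integral_ge0. Qed.

Let law_sigma_additive : semi_sigma_additive law.
Proof.
move=> /= E mE tE mUE; rewrite /law; apply: cvg_toP.
  apply: ereal_nondecreasing_is_cvgn => m n mn.
  by apply: lee_sum_nneg_natr => // k _ _; exact: integral_ge0.
by rewrite ge0_integral_bigcup//=; exact: measurable_funTS.
Qed.

HB.instance Definition _ := isMeasure.Build _ _ _ law
  law0 law_ge0 law_sigma_additive.

Let lawT : law setT = 1%E.
Proof. by rewrite /law -integral_mkcond density_total. Qed.

HB.instance Definition _ := @Measure_isProbability.Build _ _ R law lawT.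

Let lawE (A : set R) :
  law A = (\int[mu]_(t in A `&` `[0%R, +oo[) (density F t)%:E)%E.
Proof. by rewrite integral_mkcondr. Qed.

Lemma law_ray (t : R) : 0 <= t -> law `]-oo, t] = (cdf_of F t)%:E.
Proof.
move=> t0; have rayE : `]-oo, t] `&` `[0, +oo[ = `[0, t]%classic :> set R.
  by apply/seteqP; split => x /=; rewrite !in_itv/= andbT; case: (0 <= x); rewrite ?andbT ?andbF//; case.
have := lawE `]-oo, t]; rewrite rayE => lE.
rewrite /cdf_of /Rintegral -lE fineK//.
by apply: fin_num_measure; exact: measurable_itv.
Qed.

Lemma cdf_of_ge0 (t : R) : 0 <= t -> 0 <= cdf_of F t.
Proof. by move=> t0; rewrite -lee_fin -law_ray. Qed.

Lemma cdf_of_le1 (t : R) : 0 <= t -> cdf_of F t <= 1.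
Proof.
by move=> t0; rewrite -lee_fin -law_ray//; apply: probability_le1; exact: measurable_itv.
Qed.

Lemma cdf_of_le (s t : R) : 0 <= s -> s <= t -> cdf_of F s <= cdf_of F t.
Proof.
move=> s0 st; have t0 := le_trans s0 st.
rewrite -lee_fin -!law_ray//; apply: le_measure; rewrite ?inE.
- exact: measurable_itv.
- exact: measurable_itv.
- exact: subset_itvl.
Qed.

Lemma law_upper_ray (t : R) : 0 <= t -> law `]t, +oo[ = (1 - cdf_of F t)%:E.
Proof.
move=> t0; transitivity (1 - law `]-oo, t])%E; last by rewrite law_ray.
by rewrite -setCitvl; apply: probability_setC; exact: measurable_itv.
Qed.

(** The identity seen as a random variable under [law] has cdf [cdf_of F] on the nonnegative reals.
    This yields right-continuity and the limit 1 at infinity. *)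
Let idR : measurableTypeR R -> R := idfun.

#[local] HB.instance Definition _ :=
  @isMeasurableFun.Build _ _ _ _ idR (@measurable_id _ _ setT).

Let cdf_idE (t : R) : 0 <= t -> cdf (idR : {RV law >-> R}) t = (cdf_of F t)%:E.
Proof. exact: law_ray. Qed.

Lemma cdf_of_gt (q : R) : q < 1 -> exists2 t, 0 <= t & q < cdf_of F t.
Proof.
move=> q1.
have cvg1 : (fine \o cdf (idR : {RV law >-> R})) x @[x --> +oo] --> (1 : R).
  exact: fine_cvg (cvg_cdfy1 (idR : {RV law >-> R})).
have H : \forall t \near +oo, q < fine (cdf (idR : {RV law >-> R}) t).
  exact: (cvgr_gt _ cvg1).
have : \forall t \near +oo, 0 <= t /\ q < cdf_of F t.
  near=> t.
  have t0 : 0 <= t by near: t; exact: nbhs_pinfty_ge.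
  split => //; suff : q < fine (cdf (idR : {RV law >-> R}) t) by rewrite cdf_idE.
  by near: t.
by move=> /filter_ex[t [t0 qt]]; exists t.
Unshelve. all: by end_near. Qed.

(** * Quantile function and inverse transform sampling *)

Let quantile_nonempty (q : R) : q < 1 -> [set t : R | 0 <= t /\ q <= cdf_of F t] !=set0.
Proof. by move=> /cdf_of_gt[t t0 qt]; exists t; split => //; exact: ltW. Qed.

Let quantile_lbound (q : R) : has_lbound [set t : R | 0 <= t /\ q <= cdf_of F t].
Proof. by exists 0 => t []. Qed.

Lemma quantile_ge0 (q : R) : 0 <= quantile F q.
Proof.
rewrite /quantile; set S := (X in inf X); have [->|/set0P S0] := eqVneq S set0.
  by rewrite inf0.
by apply: lb_le_inf => // t [].
Qed.

Lemma quantile0 : quantile F 0 = 0.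
Proof.
apply/eqP; rewrite eq_le quantile_ge0// andbT.
by apply: ge_inf => //; split => //; exact: cdf_of_ge0.
Qed.

(** The Galois connection between quantile and cdf. Right-continuity of the cdf makes the infimum
    attained; [q < 1] makes the set nonempty, the infimum of the empty set being the default 0. *)
Lemma quantile_le (q t : R) : q < 1 -> 0 <= t ->
  (quantile F q <= t) = (q <= cdf_of F t).
Proof.
move=> q1 t0; apply/idP/idP => [Qt|qt]; last by apply: ge_inf.
have Q0 := quantile_ge0 q; apply: (@le_trans _ _ (cdf_of F (quantile F q))); last first.
  exact: cdf_of_le.
have := @cdf_right_continuous _ _ _ law (idR : {RV law >-> R}) (quantile F q).
rewrite cdf_idE// => /fine_cvg H.
apply: (cvgr_to_ge H); near=> s.
have Qs : quantile F q < s by near: s; exact: nbhs_right_gt.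
have [u [u0 qu] us] := inf_lt (quantile_nonempty q1) Qs.
suff : q <= fine (cdf (idR : {RV law >-> R}) s) by [].
rewrite cdf_idE ?(le_trans Q0 (ltW Qs))//=.
by apply: (le_trans qu); apply: cdf_of_le => //; exact: ltW.
Unshelve. all: by end_near. Qed.

(** Setting the value to 0 outside []0, 1[] avoids the default values of [quantile] and makes every
    preimage of a ray an interval or everything. *)
Let X : measurableTypeR R -> measurableTypeR R :=
  fun r : R => if 0 < r < 1 then quantile F r else 0.

Let X_ge0 (r : R) : 0 <= X r.
Proof. by rewrite /X; case: ifPn => // _; exact: quantile_ge0. Qed.

Let X_preimage (x : R) : X @^-1` `]x, +oo[ =
  if 0 <= x then `]cdf_of F x, 1[%classic else setT.
Proof.
case: ifPn => x0; apply/seteqP; split => r //=; rewrite !in_itv/= ?andbT.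
- rewrite /X; case: ifPn => [/andP[r0 r1]|_]; last by rewrite ltNge x0.
  by rewrite r1 andbT !ltNge quantile_le.
- move=> /andP[xr r1]; rewrite /X r1 (le_lt_trans (cdf_of_ge0 x0) xr)/=.
  by rewrite ltNge quantile_le// -ltNge.
- by move=> _; rewrite (lt_le_trans _ (X_ge0 r))// ltNge.
Qed.

Let mX : measurable_fun setT X.
Proof.
move=> _; apply: (measurability _ (RGenOInfty.measurableE R)) => //.
move=> _ [_ [x ->] <-]; rewrite setTI X_preimage; case: ifPn => _ //.
Qed.

#[local] HB.instance Definition _ := @isMeasurableFun.Build _ _ _ _ X mX.

Local Notation U := (uniform_prob (@ltr01 R)).

(** Inverse transform sampling: by [quantile_le], the rays []x, +oo[] have the same mass under both
    measures, and these rays are stable under intersection and generate the Borel sets. *)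
Lemma distribution_quantile (A : set (measurableTypeR R)) : measurable A ->
  distribution U (X : {RV U >-> measurableTypeR R}) A = law A.
Proof.
apply: (@measure_unique _ R (measurableTypeR R) (@RGenOInfty.G R)
  (fun k => `]- (k%:R : R), +oo[%classic) _ _ _ _
  (distribution U (X : {RV U >-> measurableTypeR R})) law).
- exact: RGenOInfty.measurableE.
- move=> _ _ [x ->] [y ->]; exists (Num.max x y).
  by apply/seteqP; split => z/=; rewrite !in_itv/= !andbT gt_max => /andP.
- by move=> k; exists (- k%:R).
- apply/seteqP; split => // x _; exists (Num.bound `|x : R|) => //=.
  rewrite in_itv/= andbT ltrNl (le_lt_trans (ler_norm _))// normrN.
  exact: archi_boundP.
- move=> _ [x ->]; suff : U (X @^-1` `]x, +oo[) = law `]x, +oo[ by [].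
  rewrite X_preimage; case: ifPn => x0.
    rewrite law_upper_ray// /uniform_prob integral_uniform_pdf.
    have -> : `]cdf_of F x, 1[ `&` `[0, 1] = `]cdf_of F x, 1[%classic :> set R.
      apply/setIidPl => r /=; rewrite !in_itv/= => /andP[xr r1].
      by rewrite (ltW r1) (ltW (le_lt_trans (cdf_of_ge0 x0) xr)).
    rewrite (eq_integral (cst 1%E)); last first.
      move=> r; rewrite inE/= in_itv/= => /andP[xr r1]; rewrite /uniform_pdf.
      by rewrite (ltW r1) (ltW (le_lt_trans (cdf_of_ge0 x0) xr)) subr0 invr1.
    rewrite integral_cst ?mul1e; last exact: measurable_itv.
    rewrite /= lebesgue_measure_itv/= lte_fin; case: ifPn => [//|].
    rewrite -leNgt => c1; have -> : cdf_of F x = 1 by apply/eqP; rewrite eq_le c1 cdf_of_le1.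
    by rewrite subrr.
  rewrite [LHS](@probability_setT _ _ _ U) lawE.
  have -> : `]x, +oo[ `&` `[0, +oo[ = `[0, +oo[%classic :> set R.
    apply/setIidPr => r /=; rewrite !in_itv/= !andbT; apply: lt_le_trans.
    by rewrite ltNge.
  by rewrite density_total.
- by move=> k; rewrite (le_lt_trans (probability_le1 _ _)) ?ltry//; exact: measurable_itv.
Qed.

Let law_dominates : law `<< mu.
Proof.
apply/null_content_dominatesP => A mA muA0.
by apply: null_set_integral => //; exact: measurable_funTS.
Qed.

(** The Radon-Nikodym derivative of [law] agrees almost everywhere with the density, since both have
    the same integral over every measurable set. *)
Lemma integral_law (g : R -> \bar R) : measurable_fun setT g ->
  (forall t, 0 <= g t)%E ->
  (\int[law]_t g t = \int[mu]_(t in `[0%R, +oo[) (g t * (density F t)%:E))%E.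
Proof.
move=> mg g0.
rewrite -(Radon_Nikodym_SigmaFinite.change_of_variables law_dominates)//.
transitivity (\int[mu]_t (g t * f0 t))%E; last first.
  rewrite [RHS]integral_mkcond; apply: eq_integral => t _.
  by rewrite /f0 !patchE; case: ifPn => //; rewrite mule0.
apply: ae_eq_integral => //.
- apply: emeasurable_funM => //.
  exact: measurable_int (Radon_Nikodym_SigmaFinite.f_integrable law_dominates).
- exact: emeasurable_funM.
- apply: ae_eqe_mul2l; apply: integral_ae_eq => //.
    exact: Radon_Nikodym_SigmaFinite.f_integrable law_dominates.
  move=> A _ mA.
  by rewrite -Radon_Nikodym_SigmaFinite.f_integral//; exact: law_dominates.
Qed.

(** * The integral H and its convex hull *)

Let vv (T : R) : R -> \bar R := (EFin \o virtual_value F) \_ `[0, T].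

Lemma virtual_value_ge0 (t : R) : 0 <= t -> 0 <= virtual_value F t.
Proof.
by move=> t0; rewrite divr_ge0// ?subr_ge0 ?cdf_of_le1// density_ge0.
Qed.

Let vv_ge0 (T t : R) : (0 <= vv T t)%E.
Proof.
apply: erestrict_ge0 => x/=; rewrite in_itv/= lee_fin => /andP[x0 _].
exact: virtual_value_ge0.
Qed.

Let mvv (T : R) : measurable_fun setT (vv T).
Proof.
apply/(measurable_restrictT _ _).1 => //; apply/measurable_EFinP.
apply: (eq_measurable_fun
  (fun t : R => (1 - fine (law `]-oo, t])) * (density F t)^-1)).
  by move=> t; rewrite inE/= in_itv/= => /andP[t0 _]; rewrite law_ray.
apply: measurable_funM.
  apply: measurable_funB => //; apply: nondecreasing_measurable => // x y xy.
  rewrite fine_le ?fin_num_measure//; try exact: measurable_itv.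
  apply: le_measure; rewrite ?inE; [exact: measurable_itv|exact: measurable_itv|].
  exact: subset_itvl.
apply: (measurableT_comp (@measurable_invr R)).
apply: measurable_funS (@density_measurable _ F) => //.
by move=> x /=; rewrite !in_itv/= andbT => /andP[].
Qed.

(* Substituting [r = F t] in the integral defining [H] gives
   [H q = \int_0^(quantile q) (1 - F t) dt], hence this bound. *)
Lemma H_fun_le_quantile (q : R) : 0 <= q < 1 -> (H_fun F q <= (quantile F q)%:E)%E.
Proof.
move=> /andP[q0 q1]; set T := quantile F q.
have T0 : 0 <= T by exact: quantile_ge0.
have hX (r : R) : 0 <= r <= q -> (h_fun F r)%:E = vv T (X r).
  move=> /andP[r0 rq].
  have XE : X r = quantile F r.
    rewrite /X (le_lt_trans rq)// andbT; case: ltgtP r0 => // <- _.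
    by rewrite quantile0.
  rewrite /vv patchE ifT ?XE// inE/= in_itv/= quantile_ge0/=.
  rewrite quantile_le ?(le_lt_trans rq)//; apply: (le_trans rq).
  by rewrite -quantile_le.
rewrite /H_fun (eq_integral (vv T \o X)); last first.
  by move=> r; rewrite inE/= in_itv/= => /hX.
have mvX : measurable_fun [set: measurableTypeR R] (vv T \o X).
  exact: (measurableT_comp (mvv T) mX).
(* Only an upper bound is needed, so the range is enlarged to the unit interval, where [X] is a
   sample of the law. *)
apply: (@le_trans _ _ (\int[mu]_(r in `[0%R, 1%R]) (vv T \o X) r)%E).
  apply: ge0_subset_integral => //; first exact: measurable_funTS.
    by move=> r _; exact: vv_ge0.
  by apply: subset_itvl; rewrite bnd_simp ltW.
have := @integral_uniform R 0 1 ltr01 (vv T \o X) mvX (fun x => vv_ge0 T (X x)).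
rewrite subr0 invr1 mul1e => <-.
rewrite -(ge0_integral_distribution (X : {RV U >-> measurableTypeR R}))//.
rewrite (eq_measure_integral law); last by move=> A mA _; exact: distribution_quantile.
rewrite integral_law//.
(* The virtual value times the density is [1 - F t], or 0 where the density vanishes, hence at most
   1. *)
apply: (@le_trans _ _ (\int[mu]_(t in `[0%R, +oo[) (cst 1%E \_ `[0%R, T]) t)%E).
  apply: ge0_le_integral => //.
  - move=> t /=; rewrite in_itv/= andbT => t0.
    by rewrite mule_ge0 ?lee_fin ?density_ge0.
  - apply: emeasurable_funM; first exact: (measurable_funTS (mvv T)).
    by apply/measurable_EFinP; exact: density_measurable.
  - by apply: measurable_funTS; apply/(measurable_restrictT _ _).1.
  - move=> t /=; rewrite in_itv/= andbT => t0.
    rewrite /vv !patchE; case: ifPn => _; last by rewrite mul0e.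
    rewrite -EFinM lee_fin /virtual_value.
    have [->|d0] := eqVneq (density F t) 0; first by rewrite mulr0.
    by rewrite divfK// gerBl cdf_of_ge0.
rewrite -integral_mkcondr setIidr; last first.
  by move=> t /=; rewrite !in_itv/= andbT => /andP[].
rewrite integral_cst ?mul1e//= lebesgue_measure_itv/= lte_fin.
by case: ifPn => _; rewrite lee_fin ?subr0.
all: exact: mvv.
Qed.

Lemma H_fun_ge0 (q : R) : (0 <= H_fun F q)%E.
Proof.
by apply: integral_ge0 => r _; rewrite lee_fin virtual_value_ge0// quantile_ge0.
Qed.

Lemma convex_hull_H_ge0 (q : R) : (0 <= convex_hull_below (H_fun F) q)%E.
Proof.
apply: (@convex_hull_below_largest _ _ (cst 0)); split => [t x y _ _|r _] /=.
  by rewrite convRE !mulr0 addr0.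
exact: H_fun_ge0.
Qed.

(** The bound of H by the quantile keeps the hull finite below 1 even when the mean is infinite, so
    [fine] loses nothing there. *)
Lemma convex_hull_H_fin_num (q : R) :
  0 <= q < 1 -> convex_hull_below (H_fun F) q \is a fin_num.
Proof.
move=> q01; rewrite ge0_fin_numE ?convex_hull_H_ge0//.
apply: (@le_lt_trans _ _ (quantile F q)%:E); last exact: ltry.
apply: le_trans (H_fun_le_quantile q01); apply: convex_hull_below_le.
by move: q01 => /andP[-> /ltW].
Qed.

Lemma convex01_hull : convex01 (fine \o convex_hull_below (H_fun F)).
Proof.
move=> p q t /andP[p0 p1] /andP[q0 q1] /andP[t0 t1].
have m0 : 0 <= t * p + (1 - t) * q.
  by rewrite addr_ge0// mulr_ge0 ?subr_ge0// ltW.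
have m1 : t * p + (1 - t) * q < 1.
  have [->|tn1] := eqVneq t 1; first by rewrite subrr mul0r mul1r addr0.
  have : t * p <= t by rewrite ler_piMr// ltW.
  have : (1 - t) * q < 1 - t by rewrite gtr_pMr// subr_gt0 lt_neqAle tn1.
  by move=> ? ?; lra.
rewrite /= -lee_fin EFinD !EFinM !fineK; last 3 first.
- by apply: convex_hull_H_fin_num; rewrite (ltW q0).
- by apply: convex_hull_H_fin_num; rewrite (ltW p0).
- by apply: convex_hull_H_fin_num; rewrite m0.
by apply: convex_hull_below_convex; apply/andP; split=> //; exact: ltW.
Qed.

(** The one fact about the ironed virtual value of an arbitrary distribution on which the surplus
    bounds rest. *)
Lemma ironed_virtual_value_nondecreasing (s t : R) : 0 <= s -> s <= t ->
  (ironed_virtual_value F s <= ironed_virtual_value F t)%E.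
Proof.
move=> s0 st; apply: rc_derivative_nondecreasing.
- exact: convex01_hull.
- exact: cdf_of_ge0.
- exact: cdf_of_le.
- by rewrite cdf_of_le1// (le_trans s0).
Qed.

End law.

(** * Residual surplus of a standard auction *)

Section residual_surplus_of_Opt.
Context {R : realType} (F : cont_dist R) (n : nat).
Implicit Types (u v : 'I_n -> R) (i j k : 'I_n).
#[local] Opaque ironed_virtual_value.
Local Notation mu := (@lebesgue_measure R).
Local Notation theta := (ironed_virtual_value F).

Lemma residual_surplusE v : residual_surplus (Opt F n) v =
  \sum_(i < n) \int[mu]_(z in `[0, v i]) Opt F n i [eta v with i |-> z].
Proof. by apply: eq_bigr => i _; rewrite /payment opprB addrC subrK. Qed.

Lemma Opt_ge0 i v : 0 <= Opt F n i v.
Proof. by rewrite /Opt; case: ifPn => // _; rewrite invr_ge0 ler0n. Qed.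

Lemma residual_surplus_ge0 v : 0 <= residual_surplus (Opt F n) v.
Proof.
rewrite residual_surplusE; apply: sumr_ge0 => i _.
by apply: Rintegral_ge0 => z _; exact: Opt_ge0.
Qed.

Lemma winnersE (top : R) u k : (forall i, 0 <= u i <= top) -> u k = top ->
  winners F u = [set i | (theta top <= theta (u i))%E]%SET.
Proof.
move=> utop uk; apply/setP => i; rewrite !inE; apply/forallP/idP => [/(_ k)|H j].
  by rewrite uk.
apply: le_trans H; have /andP[uj0 ujt] := utop j.
exact: ironed_virtual_value_nondecreasing.
Qed.

Variables (v : 'I_n -> R) (top : R) (i0 j0 : 'I_n).
Hypotheses (vtop : forall i, 0 <= v i <= top).
Hypotheses (ij0 : i0 != j0) (vi0 : v i0 = top) (vj0 : v j0 = top).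

Let W := winners F v.

Let WE : W = [set i | (theta top <= theta (v i))%E]%SET.
Proof. exact: winnersE vi0. Qed.

Let inW i : (i \in W) = (theta top <= theta (v i))%E.
Proof. by rewrite WE inE. Qed.

Let W_gt0 : 0 < #|W|%:R :> R.
Proof.
by rewrite ltr0n; apply/card_gt0P; exists i0; rewrite inW vi0.
Qed.

(** The values tied with [top]. By monotonicity this set is upward closed, hence an interval; its
    bottom is the threshold of the lottery. *)
Let A := [set z : R | 0 <= z /\ (theta top <= theta z)%E].

Let mA : measurable A.
Proof.
apply: is_interval_measurable => x y [x0 Ax] [y0 Ay] z /andP[xz zy].
split; first exact: le_trans xz.
by apply: (le_trans Ax); exact: ironed_virtual_value_nondecreasing.
Qed.

(** When one agent lowers its report, the other agent holding [top] keeps the maximum in place, so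
    the criterion for winning does not move. *)
Let deviation i z : 0 <= z <= v i -> winners F [eta v with i |-> z] =
  [set k | (theta top <= theta ([eta v with i |-> z] k))%E]%SET.
Proof.
move=> /andP[z0 zv].
have [k ki vk] : exists2 k, k != i & v k = top.
  by have [<-|] := eqVneq i0 i; [exists j0; rewrite 1?eq_sym|exists i0].
apply: (@winnersE _ _ k); last by rewrite /= (negbTE ki).
move=> j /=; case: ifPn => [/eqP _|_]; last exact: vtop.
by rewrite z0 (le_trans zv)//; have /andP[] := vtop i.
Qed.

Let loser_below i z : i \notin W -> 0 <= z <= v i ->
  (theta top <= theta z)%E = false.
Proof.
rewrite inW -ltNge => iW /andP[z0 zv]; apply: lt_geF; apply: le_lt_trans iW.
exact: ironed_virtual_value_nondecreasing.
Qed.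

(** A winner reporting a value in [A] leaves the set of winners unchanged and gets the item with
    probability [1 / #|W|]; below [A] it gets nothing. A loser reporting less than its value still
    loses. *)
Let integral_Opt i : \int[mu]_(z in `[0, v i]) Opt F n i [eta v with i |-> z] =
  if i \in W then #|W|%:R^-1 * fine (mu (`[0, v i] `&` A)) else 0.
Proof.
case: ifPn => iW; last first.
  rewrite (@eq_Rintegral _ _ _ _ _ (cst 0)); last first.
    move=> z; rewrite inE/= in_itv/= => zi; rewrite /Opt deviation// inE/= eqxx.
    have := loser_below iW zi; case: ifP => [_ H|_ _]; first discriminate H.
    reflexivity.
  by rewrite Rintegral_cst ?mul0r//; exact: measurable_itv.
have vW : (theta top <= theta (v i))%E = true by rewrite -inW.
transitivity (\int[mu]_(z in `[0, v i]) ((cst (#|W|%:R^-1 : R)) \_ A) z).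
  apply: eq_Rintegral => z; rewrite inE/= in_itv/= => zi.
  rewrite /Opt deviation// inE/= eqxx patchE.
  rewrite (_ : (z \in A) = (theta top <= theta z)%E); last first.
    by apply/idP/idP => [/set_mem[]//|Az]; apply/mem_set; split => //; case/andP: zi.
  case: ifPn => // Az; congr (_%:R^-1); apply: eq_card => k.
  rewrite inE/= inW; case: ifP => [/eqP ki|_]; last reflexivity.
  rewrite ki; exact: etrans Az (esym vW).
rewrite -Rintegral_mkcondr Rintegral_cst//.
  by apply: measurableI => //; exact: measurable_itv.
Qed.

Let fine_mu_le i (b : R) (B : set R) : measurable B -> b <= v i ->
  B `<=` `[b, v i] -> fine (mu B) <= v i - b.
Proof.
move=> mB bv sB; have vb : mu `[b, v i] = (v i - b)%:E.
  rewrite lebesgue_measure_itv/= lte_fin; case: ltgtP bv => // -> _.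
  by rewrite subrr.
have Bvb : (mu B <= (v i - b)%:E)%E by rewrite -vb; apply: le_measure; rewrite ?inE.
rewrite -lee_fin fineK// ge0_fin_numE//.
by apply: (le_lt_trans Bvb); exact: ltry.
Qed.

Let le_fine_mu i (a : R) (B : set R) : measurable B -> 0 <= a -> a <= v i ->
  B `<=` `[0, v i] -> `]a, v i] `<=` B -> v i - a <= fine (mu B).
Proof.
move=> mB a0 av sB aB; have va : mu `]a, v i] = (v i - a)%:E.
  rewrite lebesgue_measure_itv/= lte_fin; case: ltgtP av => // -> _.
  by rewrite subrr.
rewrite -lee_fin fineK ?ge0_fin_numE//.
  by rewrite -va; apply: le_measure; rewrite ?inE.
apply: (@le_lt_trans _ _ (mu `[0, v i])); first by apply: le_measure; rewrite ?inE.
by rewrite lebesgue_measure_itv/=; case: ifPn => // _; rewrite -EFinB ltry.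
Qed.

(** Either hypothesis on [b] puts all of [A] above [b], so a winner collects at most the length
    [v i - b]. *)
Lemma residual_surplus_Opt_le (b : R) : 0 <= b ->
  (b = 0 \/ ~~ (theta top <= theta b)%E) ->
  residual_surplus (Opt F n) v <=
    #|winners F v|%:R^-1 * \sum_(i in winners F v) (v i - b).
Proof.
move=> b0 bP; rewrite residual_surplusE -/W mulr_sumr [leRHS]big_mkcond/=.
apply: ler_sum => i _; rewrite integral_Opt; case: ifPn => // iW.
rewrite ler_wpM2l ?invr_ge0 ?(ltW W_gt0)//.
have bA z : A z -> b <= z.
  move=> [z0 Az]; case: bP => [->//|]; apply: contraNT; rewrite -ltNge => zb.
  by apply: (le_trans Az); apply: ironed_virtual_value_nondecreasing => //; exact: ltW.
have Avi : A (v i).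
  by split; [case/andP: (vtop i)|rewrite -inW].
apply: fine_mu_le; [by apply: measurableI => //; exact: measurable_itv|exact: bA|].
by move=> z [/=]; rewrite !in_itv/= => /andP[_ ->] /bA ->.
Qed.

(** [A] contains everything from [a] to [top], so each winner contributes at least [d / #|W|]. *)
Lemma le_residual_surplus_Opt (a d : R) : 0 <= a ->
  (forall z, a < z <= top -> (theta top <= theta z)%E) ->
  (forall i, i \in winners F v -> a + d <= v i) -> 0 <= d ->
  d <= residual_surplus (Opt F n) v.
Proof.
move=> a0 Aa dW d0; rewrite residual_surplusE.
have -> : d = \sum_(i in W) #|W|%:R^-1 * d.
  rewrite -mulr_sumr sumr_const.
  by rewrite -[d *+ _]mulr_natr mulrCA mulVf ?mulr1// gt_eqF.
rewrite [leLHS]big_mkcond/=; apply: ler_sum => i _; rewrite integral_Opt.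
case: ifPn => // iW; rewrite ler_wpM2l ?invr_ge0 ?(ltW W_gt0)//.
have adv := dW _ iW.
apply: (@le_trans _ _ (v i - a)); first by rewrite lerBrDl.
apply: (le_fine_mu _ a0).
- by apply: measurableI; [exact: measurable_itv|exact: mA].
- by apply: le_trans adv; rewrite lerDl.
- by move=> z [].
move=> z /=; rewrite in_itv/= => /andP[az zv]; split => /=.
  by rewrite in_itv/= zv andbT (le_trans a0)// ltW.
split; first by rewrite (le_trans a0)// ltW.
by apply: Aa; rewrite az (le_trans zv)//; case/andP: (vtop i).
Qed.

End residual_surplus_of_Opt.

(** * A distribution that irons exactly above a given threshold *)

Section affine_integral.
Context {R : realType}.
Local Notation mu := (@lebesgue_measure R).

Lemma integral_onem (c x y : R) : x <= y ->
  (\int[mu]_(r in `[x, y]) (c * (1 - r))%:E =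
   (c * ((y - y ^+ 2 / 2) - (x - x ^+ 2 / 2)))%:E)%E.
Proof.
rewrite le_eqVlt => /predU1P[<-|xy].
  by rewrite subrr mulr0 set_itv1 integral_set1.
pose P r : R := c * (r - r ^+ 2 / 2).
have dP (r : R) : is_derive r 1 P (c * (1 - r)).
  rewrite /P; apply: is_derive_eq.
  by rewrite !scaler0 add0r /GRing.scale/= !mulr1; field.
have cP : continuous P.
  move=> r; apply: differentiable_continuous; apply/derivable1_diffP.
  exact: ex_derive.
have cf : continuous (fun r : R => c * (1 - r)).
  move=> r; apply: differentiable_continuous; apply/derivable1_diffP.
  exact: ex_derive.
rewrite (@continuous_FTC2 _ _ P)//.
- by rewrite -EFinB; congr EFin; rewrite /P; ring.
- exact: continuous_subspaceT.
- split.
  + by move=> r _; exact: ex_derive.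
  + by apply: cvg_at_right_filter; exact: cP.
  + by apply: cvg_at_left_filter; exact: cP.
- by move=> r _; rewrite derive1E derive_val.
Qed.

End affine_integral.

Section two_step_distribution.
Context {R : realType} (a : R).
Hypothesis a01 : 0 < a <= 1.
Local Notation mu := (@lebesgue_measure R).

Let a0 : 0 < a. Proof. by case/andP: a01. Qed.
Let a1 : a <= 1. Proof. by case/andP: a01. Qed.

(** Half of the mass is uniform on [[0, a[], half on [[a, a + 4]]. The virtual value decreases on
    each step and is ironed to its average, [3 / 2 * a] on the first and 2 on the second. The length
    4 makes the second average larger for [a <= 1] and the second step reach beyond 1. *)
Definition two_step_density (t : R) : R :=
  if t < a then (2 * a)^-1 else if t <= a + 4 then 8^-1 else 0.

Let f := two_step_density.

Let measurable_two_step_density : measurable_fun setT f.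
Proof.
have m2 : measurable_fun setT (fun t : R => if t <= a + 4 then 8^-1 else 0 : R).
  by apply: measurable_fun_if => //; exact: measurable_fun_ler.
apply: measurable_fun_if => //; first exact: measurable_fun_ltr.
exact: measurable_funTS.
Qed.

Let f_ge0 (t : R) : 0 <= f t.
Proof.
by rewrite /f /two_step_density; case: ifPn => _; [|case: ifPn => _]; rewrite ?invr_ge0 ?mulr_ge0// ltW.
Qed.

Let integral_f (E : set R) : measurable E -> E `<=` `[0, +oo[ ->
  (\int[mu]_(t in E) (f t)%:E =
   ((2 * a)^-1)%:E * mu (E `&` `[0%R, a[) + (8^-1)%:E * mu (E `&` `[a, (a + 4)%R]))%E.
Proof.
move=> mE E0.
transitivity (\int[mu]_(t in E) ((cst ((2 * a)^-1)%:E \_ `[0%R, a[) t +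
    (cst (8^-1)%:E \_ `[a, (a + 4)%R]) t))%E.
  apply: eq_integral => t /[!inE] /E0; rewrite /= in_itv/= andbT => t0.
  rewrite !patchE !mem_setE !in_itv/= t0 /f /two_step_density leNgt.
  by case: ltP => ta /=; rewrite ?adde0//; case: ifPn; rewrite add0e.
rewrite ge0_integralD//.
- by rewrite -!integral_mkcondr !integral_cst//; exact: measurableI.
- by move=> t _; apply: erestrict_ge0 => s _; rewrite lee_fin invr_ge0 mulr_ge0// ltW.
- by apply: measurable_funTS; apply/(measurable_restrictT _ _).1.
- by move=> t _; apply: erestrict_ge0 => s _; rewrite lee_fin invr_ge0.
- by apply: measurable_funTS; apply/(measurable_restrictT _ _).1.
Qed.

Let f_total : (\int[mu]_(t in `[0%R, +oo[) (f t)%:E = 1)%E.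
Proof.
rewrite integral_f// setIidr; last by apply: subset_itvl.
rewrite setIidr; last by move=> t /=; rewrite !in_itv/= andbT => /andP[/(le_trans (ltW a0))].
rewrite !lebesgue_measure_itv/= !lte_fin a0 ltrDl ltr0n/= -!EFinB -!EFinM -EFinD.
by congr EFin; field; rewrite gt_eqF.
Qed.

Definition two_step : cont_dist R := @ContDist R two_step_density
  (measurable_funTS measurable_two_step_density) (fun t _ => f_ge0 t) f_total.

Lemma two_step_cdf_low (t : R) : 0 <= t <= a -> cdf_of two_step t = t / (2 * a).
Proof.
move=> /andP[t0 ta]; rewrite /cdf_of /Rintegral integral_f//; last first.
  by apply: subset_itvl.
have m1 : mu (`[0, t] `&` `[0, a[) = t%:E.
  have [tlta|talt] := ltP t a.
    rewrite setIidl; last by apply: subset_itvl; rewrite bnd_simp.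
    rewrite lebesgue_measure_itv/= lte_fin; case: ltgtP t0 => // [_|<-] _.
      by rewrite -EFinB subr0.
    by [].
  have -> : t = a by apply/eqP; rewrite eq_le ta.
  rewrite setIidr; last by apply: subset_itvl; rewrite bnd_simp.
  by rewrite lebesgue_measure_itv/= lte_fin a0 -EFinB subr0.
have m2 : mu (`[0, t] `&` `[a, a + 4]) = 0%E.
  apply/eqP; rewrite eq_le measure_ge0 andbT.
  have <- : mu [set a] = 0%E by rewrite lebesgue_measure_set1.
  apply: le_measure; rewrite ?inE//; first exact: measurableI.
  move=> s [/=]; rewrite !in_itv/= => /andP[_ st] /andP[as_ _].
  by apply/eqP; rewrite eq_le as_ (le_trans st).
by rewrite m1 m2 mule0 adde0 -EFinM/= mulrC.
Qed.

Lemma two_step_cdf_high (t : R) : a <= t <= a + 4 ->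
  cdf_of two_step t = 1 / 2 + (t - a) / 8.
Proof.
move=> /andP[at_ t4]; rewrite /cdf_of /Rintegral integral_f//; last first.
  by apply: subset_itvl.
have m1 : mu (`[0, t] `&` `[0, a[) = a%:E.
  rewrite setIidr; last by apply: subset_itvl; rewrite bnd_simp.
  by rewrite lebesgue_measure_itv/= lte_fin a0 -EFinB subr0.
have m2 : mu (`[0, t] `&` `[a, a + 4]) = (t - a)%:E.
  have -> : `[0, t] `&` `[a, a + 4] = `[a, t]%classic :> set R.
    apply/seteqP; split => s /=; rewrite !in_itv/=.
      by move=> [/andP[_ ->] /andP[->]].
    by move=> /andP[as_ st]; rewrite as_ st (le_trans (ltW a0) as_) (le_trans st).
  rewrite lebesgue_measure_itv/= lte_fin; case: ltgtP at_ => // <- _.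
  by rewrite subrr.
rewrite m1 m2 -!EFinM -EFinD/=; field.
by rewrite gt_eqF.
Qed.

Let rank (r : R) : R := if r < 1 / 2 then 2 * a * r else a + 8 * (r - 1 / 2).

Lemma two_step_quantile (r : R) : 0 <= r <= 1 -> quantile two_step r = rank r.
Proof.
move=> /andP[r0 r1].
have rank0 : 0 <= rank r.
  rewrite /rank; case: ltP => r2; first by rewrite !mulr_ge0// ltW.
  by have := a0; lra.
suff H t : 0 <= t -> (r <= cdf_of two_step t) = (rank r <= t).
  have -> : quantile two_step r = inf `[rank r, +oo[%classic.
    congr inf; apply/seteqP; split => t /=; rewrite in_itv/= andbT.
      by move=> [t0]; rewrite H.
    by move=> rt; have t0 := le_trans rank0 rt; rewrite H.
  by rewrite inf_itv// bnd_simp.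
move=> t0.
have [ta|ta] := ltP t a.
  rewrite two_step_cdf_low ?t0 ?(ltW ta)// ler_pdivlMr ?mulr_gt0// /rank.
  case: ltP => r2; first by rewrite mulrC.
  rewrite [RHS]leNgt (lt_le_trans ta); last by lra.
  apply/negbTE; rewrite -ltNge; apply: (lt_le_trans ta).
  have : a * (1 / 2) <= a * r by rewrite ler_pM2l.
  by lra.
have [t4|t4] := leP t (a + 4).
  rewrite two_step_cdf_high ?ta// /rank; case: ltP => r2.
    have -> : 2 * a * r <= t.
      apply: le_trans ta.
      have : a * r <= a * (1 / 2) by rewrite ler_pM2l// ltW.
      by lra.
    by apply/idP; have := ta; lra.
  by apply/idP/idP => ?; lra.
have -> : rank r <= t.
  apply: le_trans (ltW t4); rewrite /rank; case: ltP => r2; last by lra.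
  have : a * r <= a * (1 / 2) by rewrite ler_pM2l// ltW.
  by have := a0; lra.
apply/idP; apply: (le_trans r1).
apply: (@le_trans _ _ (cdf_of two_step (a + 4))).
  by rewrite two_step_cdf_high ?lexx ?lerDl//; lra.
by apply: cdf_of_le; [have := a0; lra|exact: ltW].
Qed.

Lemma two_step_h_low (r : R) : 0 <= r < 1 / 2 -> h_fun two_step r = 2 * a * (1 - r).
Proof.
move=> /andP[r0 r2].
have ar : a * r < a * (1 / 2) by rewrite ltr_pM2l.
have ar0 : 0 <= a * r by rewrite mulr_ge0// ltW.
rewrite /h_fun two_step_quantile; last by apply/andP; split=> //; lra.
rewrite /rank r2 /virtual_value two_step_cdf_low; last first.
  by apply/andP; split; lra.
rewrite /= /two_step_density ifT; last by lra.
by field; rewrite gt_eqF.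
Qed.

Lemma two_step_h_high (r : R) : 1 / 2 <= r <= 1 -> h_fun two_step r = 8 * (1 - r).
Proof.
move=> /andP[r2 r1].
rewrite /h_fun two_step_quantile; last by apply/andP; split=> //; lra.
rewrite /rank ltNge r2/= /virtual_value two_step_cdf_high; last first.
  by apply/andP; split; lra.
rewrite /= /two_step_density ifF; last by apply/negbTE; rewrite -leNgt; lra.
rewrite ifT; last by lra.
by field.
Qed.

(** * H and its convex hull for the two-step distribution *)

Let measurable_onem (c : R) (A : set R) : measurable_fun A (fun r => (c * (1 - r))%:E).
Proof.
apply/measurable_EFinP; apply: measurable_funTS; apply: measurable_funM => //.
exact: measurable_funB.
Qed.

Lemma two_step_H_low (q : R) : 0 <= q <= 1 / 2 ->
  H_fun two_step q = (2 * a * (q - q ^+ 2 / 2))%:E.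
Proof.
move=> /andP[q0 q2].
transitivity (\int[mu]_(r in `[0%R, q]) (2 * a * (1 - r))%:E)%E; last first.
  by rewrite integral_onem//; congr EFin; field.
(* The right endpoint is dropped because at [q = 1 / 2] the function [h_fun] already follows its
   other formula. *)
rewrite /H_fun; rewrite -[RHS]integral_itv_bndo_bndc; last exact: measurable_onem.
rewrite -[LHS]integral_itv_bndo_bndc.
  apply: eq_integral => r; rewrite inE/= in_itv/= => /andP[r0 rq].
  by rewrite two_step_h_low// r0 (lt_le_trans rq).
apply: (eq_measurable_fun (fun r : R => (2 * a * (1 - r))%:E)).
  move=> r; rewrite inE/= in_itv/= => /andP[r0 rq].
  by rewrite two_step_h_low// r0 (lt_le_trans rq).
exact: measurable_onem.
Qed.

(** Here [3 / 4 * a] is H at 1/2, and 3/8 is the value of [q - q ^+ 2 / 2] at 1/2. *)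
Lemma two_step_H_high (q : R) : 1 / 2 <= q <= 1 ->
  H_fun two_step q = (3 / 4 * a + 8 * (q - q ^+ 2 / 2 - 3 / 8))%:E.
Proof.
move=> /andP[q2 q1].
have mh1 : measurable_fun (`[0, (1 / 2)[%classic : set R) (fun r => (h_fun two_step r)%:E).
  apply: (eq_measurable_fun (fun r : R => (2 * a * (1 - r))%:E)).
    by move=> r; rewrite inE/= in_itv/= => r0; rewrite two_step_h_low.
  exact: measurable_onem.
have hq r : r \in (`[(1 / 2), q]%classic : set R) -> (h_fun two_step r)%:E = (8 * (1 - r))%:E.
  rewrite inE/= in_itv/= => /andP[r0 rq].
  by rewrite two_step_h_high// r0 (le_trans rq).
have mh2 : measurable_fun (`[(1 / 2), q]%classic : set R) (fun r => (h_fun two_step r)%:E).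
  apply: (eq_measurable_fun (fun r : R => (8 * (1 - r))%:E)).
    by move=> r /hq ->.
  exact: measurable_onem.
have splitq : `[0, q]%classic = `[0, (1 / 2)[%classic `|` `[(1 / 2), q]%classic :> set R.
  apply/seteqP; split => r /=; rewrite !in_itv/=.
    by move=> /andP[r0 rq]; rewrite r0 rq/= andbT; case: (ltP r (1 / 2)); [left|right].
  case=> /andP[r0 rq]; first by rewrite r0 (le_trans (ltW rq)).
  by rewrite rq andbT (le_trans _ r0)//; lra.
rewrite /H_fun splitq ge0_integral_setU//.
- rewrite integral_itv_bndo_bndc// -/(H_fun two_step (1 / 2)).
  rewrite two_step_H_low; last by apply/andP; split; lra.
  have -> : (\int[mu]_(r in `[(1 / 2)%R, q]) (h_fun two_step r)%:E =
      (8 * ((q - q ^+ 2 / 2) - (1 / 2 - (1 / 2) ^+ 2 / 2)))%:E)%E.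
    by rewrite -integral_onem//; apply: eq_integral => r; exact: hq.
  by rewrite -EFinD; congr EFin; field.
- apply: (proj2 (measurable_funU _ _ _)) (conj mh1 mh2); exact: measurable_itv.
- by move=> r _; rewrite lee_fin virtual_value_ge0// quantile_ge0.
- by apply/disj_setPS => r [] /=; rewrite !in_itv/= => /andP[_ +] /andP[+ _]; case: ltP.
Qed.

(** H is concave on each half of [[0, 1]], so its hull consists of the two chords [line1] and
    [line2]. Their maximum is the hull because the slopes increase, [s1] being less than 2. *)
Let s1 : R := 3 / 2 * a.
Let line1 (q : R) := s1 * q.
Let line2 (q : R) := s1 / 2 + 2 * (q - 1 / 2).
Let phi (q : R) := Num.max (line1 q) (line2 q).

Let convex_phi : convex_minorant (H_fun two_step) phi.
Proof.
have cphi (t x y : R) : 0 <= t <= 1 ->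
    phi (t * x + (1 - t) * y) <= t * phi x + (1 - t) * phi y.
  move=> /andP[t0 t1]; have {}t1 : 0 <= 1 - t by rewrite subr_ge0.
  rewrite {1}/phi ge_max; apply/andP; split.
    have := ler_wpM2l t0 (_ : line1 x <= phi x).
    have := ler_wpM2l t1 (_ : line1 y <= phi y).
    by rewrite !le_max !lexx /= /line1 => /(_ isT) ? /(_ isT) ?; lra.
  have := ler_wpM2l t0 (_ : line2 x <= phi x).
  have := ler_wpM2l t1 (_ : line2 y <= phi y).
  by rewrite !le_max !lexx !orbT /= /line2 => /(_ isT) ? /(_ isT) ?; lra.
split=> [t x y _ _|q /andP[q0 q1]].
  by apply: (cphi t%:num x y); apply/andP; split.
have [q2|q2] := leP q (1 / 2).
  rewrite two_step_H_low ?q0// lee_fin ge_max.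
  (* [h] is the difference between H and its chord [line1], and [h2] that between the two lines. The
     other half is treated alike, up to a factor 4 in [h]. *)
  have h : 0 <= a * q * (1 / 2 - q).
    by rewrite !mulr_ge0 ?subr_ge0// ltW.
  have h2 : 0 <= (2 - s1) * (1 / 2 - q).
    by rewrite mulr_ge0 ?subr_ge0// /s1; have := a1; lra.
  by rewrite /line1 /line2 /s1 in h2 *; apply/andP; split; lra.
rewrite two_step_H_high ?(ltW q2)// lee_fin ge_max.
have h : 0 <= (q - 1 / 2) * (1 - q) by rewrite mulr_ge0 ?subr_ge0// ltW.
have h2 : 0 <= (2 - s1) * (q - 1 / 2).
  by rewrite mulr_ge0 ?subr_ge0 ?(ltW q2)// /s1; have := a1; lra.
by rewrite /line1 /line2 /s1 in h2 *; apply/andP; split; lra.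
Qed.

Let hull := convex_hull_below (H_fun two_step).

(** The minorant [phi] bounds the hull from below. Convexity bounds it from above by the chord
    between 0 and 1/2, where H meets [line1]. *)
Let hull_low (q : R) : 0 <= q <= 1 / 2 -> hull q = (line1 q)%:E.
Proof.
move=> /andP[q0 q2]; apply/eqP; rewrite eq_le; apply/andP; split; last first.
  apply: le_trans (convex_hull_below_largest q convex_phi).
  by rewrite lee_fin le_max lexx.
have t01 : 0 <= 2 * q <= 1 by apply/andP; split; lra.
have := @convex_hull_below_convex _ (H_fun two_step) (1 / 2) 0 (2 * q)
  ltac:(lra) ltac:(lra) t01.
have -> : 2 * q * (1 / 2) + (1 - 2 * q) * 0 = q by field.
move=> /le_trans; apply.
have t0 : (0 <= (2 * q)%:E)%E by rewrite lee_fin; lra.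
have t1 : (0 <= (1 - 2 * q)%:E)%E by rewrite lee_fin; lra.
have h1 := @convex_hull_below_le _ (H_fun two_step) (1 / 2) ltac:(lra).
have h0 := @convex_hull_below_le _ (H_fun two_step) 0 ltac:(lra).
apply: (le_trans (leeD (lee_wpmul2l t0 h1) (lee_wpmul2l t1 h0))).
rewrite !two_step_H_low; [|lra|lra].
by rewrite -!EFinM -EFinD lee_fin /line1 /s1; lra.
Qed.

Let hull_high (q : R) : 1 / 2 <= q <= 1 -> hull q = (line2 q)%:E.
Proof.
move=> /andP[q2 q1]; apply/eqP; rewrite eq_le; apply/andP; split; last first.
  apply: le_trans (convex_hull_below_largest q convex_phi).
  by rewrite lee_fin le_max lexx orbT.
have t01 : 0 <= 2 * q - 1 <= 1 by apply/andP; split; lra.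
have := @convex_hull_below_convex _ (H_fun two_step) 1 (1 / 2) (2 * q - 1)
  ltac:(lra) ltac:(lra) t01.
have -> : (2 * q - 1) * 1 + (1 - (2 * q - 1)) * (1 / 2) = q by field.
move=> /le_trans; apply.
have t0 : (0 <= (2 * q - 1)%:E)%E by rewrite lee_fin; lra.
have t1 : (0 <= (1 - (2 * q - 1))%:E)%E by rewrite lee_fin; lra.
have h1 := @convex_hull_below_le _ (H_fun two_step) 1 ltac:(lra).
have h0 := @convex_hull_below_le _ (H_fun two_step) (1 / 2) ltac:(lra).
apply: (le_trans (leeD (lee_wpmul2l t0 h1) (lee_wpmul2l t1 h0))).
rewrite !two_step_H_high; [|lra|lra].
by rewrite -!EFinM -EFinD lee_fin /line2 /s1; lra.
Qed.

Let derive_hull_low (q : R) : 0 < q < 1 / 2 ->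
  derivable (fine \o hull) q 1 /\ (fine \o hull)^`()%classic q = s1.
Proof.
move=> /andP[q0 q2].
have dl : is_derive q 1 line1 s1.
  by apply: is_derive_eq; rewrite /GRing.scale/= mulr1.
have : \near q, line1 q = (fine \o hull) q.
  near=> r; rewrite /= hull_low//; apply/andP; split.
    by apply: ltW; near: r; exact: lt_nbhsr.
  by apply: ltW; near: r; exact: lt_nbhsl.
move=> /near_eq_is_derive/(_ dl) dh; split; first exact: ex_derive.
by rewrite derive1E derive_val.
Unshelve. all: by end_near. Qed.

Let derive_hull_high (q : R) : 1 / 2 < q < 1 ->
  derivable (fine \o hull) q 1 /\ (fine \o hull)^`()%classic q = 2.
Proof.
move=> /andP[q2 q1].
have dl : is_derive q 1 line2 2.
  by apply: is_derive_eq; rewrite /GRing.scale/=; ring.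
have : \near q, line2 q = (fine \o hull) q.
  near=> r; rewrite /= hull_high//; apply/andP; split.
    by apply: ltW; near: r; exact: lt_nbhsr.
  by apply: ltW; near: r; exact: lt_nbhsl.
move=> /near_eq_is_derive/(_ dl) dh; split; first exact: ex_derive.
by rewrite derive1E derive_val.
Unshelve. all: by end_near. Qed.

(** Comparison with the derivative at a point between [q] and 1/2 also covers [q = 0], an endpoint
    at which [rc_derivative] is a limit. *)
Lemma two_step_ironed_low (t : R) : 0 <= t < a ->
  (ironed_virtual_value two_step t < 2%:E)%E.
Proof.
move=> /andP[t0 ta]; pose q := t / (2 * a).
have q0 : 0 <= q by rewrite divr_ge0// mulr_ge0// ltW.
have q2 : q < 1 / 2 by rewrite ltr_pdivrMr ?mulr_gt0//; lra.
apply: (@le_lt_trans _ _ s1%:E); last by rewrite lte_fin /s1; have := a1; lra.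
rewrite /ironed_virtual_value two_step_cdf_low ?t0 ?(ltW ta)// -/q.
have [dr <-] := @derive_hull_low ((q + 1 / 2) / 2) ltac:(lra).
by apply: rc_derivative_le => //; [exact: convex01_hull|lra|lra].
Qed.

Lemma two_step_ironed_high (t : R) : a < t < a + 4 ->
  ironed_virtual_value two_step t = 2%:E.
Proof.
move=> /andP[ta t4]; pose q := 1 / 2 + (t - a) / 8.
have q2 : 1 / 2 < q by rewrite /q; lra.
have q1 : q < 1 by rewrite /q; lra.
rewrite /ironed_virtual_value two_step_cdf_high ?(ltW ta) ?(ltW t4)// -/q.
apply/eqP; rewrite eq_le; apply/andP; split.
  have [dr <-] := @derive_hull_high ((q + 1) / 2) ltac:(lra).
  by apply: rc_derivative_le => //; [exact: convex01_hull|lra|lra|lra].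
have [dr <-] := @derive_hull_high ((q + 1 / 2) / 2) ltac:(lra).
by apply: le_rc_derivative => //; [exact: convex01_hull|lra|lra|lra].
Qed.

End two_step_distribution.

(** * Profiles with a gap *)

Section gap_profile.
Variable N : nat.
Hypothesis N0 : (0 < N)%N.

(** The factor [N * N] makes each level outnumber all better ones by that ratio; the factor 2
    absorbs the extra agent 0 in the count. *)
Definition agent_base : nat := (2 * N * N)%N.

Definition agent_count : nat := (agent_base ^ (N * N)).+1.

(** The least [j] with [i <= agent_base ^ j]. Agents 0 and 1 both get level 0, which provides the
    two agents of top value. *)
Definition agent_level (i : nat) : nat := up_log agent_base i.

Definition displaced (k j : nat) : nat :=
  if (k * N < j < k.+1 * N)%N then (k.+1 * N)%N else j.

Let base_gt1 : (1 < agent_base)%N.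
Proof.
have : (0 < N * N)%N by rewrite muln_gt0 N0.
by rewrite /agent_base -mulnA; lia.
Qed.

Lemma agent_level_le (i j : nat) : (agent_level i <= j)%N = (i <= agent_base ^ j)%N.
Proof.
apply/idP/idP => [ij|]; last exact: up_log_min.
by apply: leq_trans (up_logP i base_gt1) _; rewrite leq_exp2l.
Qed.

Lemma agent_level_max (i : 'I_agent_count) : (agent_level i <= N * N)%N.
Proof. by rewrite agent_level_le -ltnS ltn_ord. Qed.

Lemma agent_level0 : agent_level 0 = 0%N.
Proof. by apply/eqP; rewrite -leqn0 agent_level_le. Qed.

Lemma agent_level1 : agent_level 1 = 0%N.
Proof. by apply/eqP; rewrite -leqn0 agent_level_le expn0. Qed.

Lemma displaced_max (k j : nat) :
  (k < N)%N -> (j <= N * N)%N -> (displaced k j <= N * N)%N.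
Proof. by move=> kN jm; rewrite /displaced; case: ifP => // _; rewrite leq_mul2r kN orbT. Qed.

(** No displaced level lies strictly inside block [k], so a cutoff [J] in this block acts as the
    cutoff [k * N]. *)
Lemma displaced_le (J k j : nat) :
  (displaced k j <= J)%N = (j <= if (J %/ N)%N == k then k * N else J)%N.
Proof.
have JE : ((J %/ N)%N == k) = (k * N <= J < k.+1 * N)%N.
  by rewrite eqn_leq -ltnS ltn_divLR// leq_divRL// andbC.
rewrite JE /displaced; case: ifPn; case: ifPn; move=> *; apply/idP/idP; lia.
Qed.

Lemma card_agents_lt (x : nat) : (x <= agent_count)%N ->
  #|[set i : 'I_agent_count | (i < x)%N]%SET| = x.
Proof.
move=> xn; rewrite -sum1dep_card -(big_ord_widen _ (fun=> 1%N) xn).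
by rewrite sum1_card card_ord.
Qed.

(** Strictly better winners are at most a fraction [1 / N ^ 2] of all winners, so even at value 1
    each they add only that much to the average. *)
Lemma card_agent_level_lt (J : nat) : (J <= N * N)%N ->
  (#|[set i : 'I_agent_count | (agent_level i < J)%N]%SET| * (N * N) <=
   #|[set i : 'I_agent_count | (agent_level i <= J)%N]%SET|)%N.
Proof.
have cardE j : (j <= N * N)%N ->
    #|[set i : 'I_agent_count | (agent_level i <= j)%N]%SET| = (agent_base ^ j).+1.
  move=> jm; rewrite -[RHS]card_agents_lt; last by rewrite ltnS leq_exp2l.
  by apply: eq_card => i; rewrite !inE agent_level_le ltnS.
case: J => [|J] Jm.
  by rewrite (_ : [set i | _]%SET = finset.set0) ?cards0//; apply/setP => i; rewrite !inE.
rewrite (cardE _ Jm) (_ : #|_| = (agent_base ^ J).+1); last first.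
  by rewrite -cardE ?(ltnW Jm)//; apply: eq_card => i; rewrite !inE.
have : (0 < agent_base ^ J)%N by rewrite expn_gt0 (ltnW base_gt1).
rewrite expnS; set B := (_ ^ J)%N; rewrite /agent_base => B0.
have : ((B.+1) * (N * N) <= (2 * B) * (N * N))%N by rewrite leq_mul2r; lia.
by lia.
Qed.

(** * Residual surplus on the gap profiles *)

Context {R : realType}.
#[local] Opaque ironed_virtual_value.

(* Level [j] carries the value [1 - j / N ^ 2] and roughly [agent_base ^ j]
   agents; the agents strictly inside the [k]-th block of [N] levels are moved to
   the bottom of the block, which leaves a gap of width [1 / N]. *)
Definition gap_profile (k : nat) (i : 'I_agent_count) : R :=
  1 - (displaced k (agent_level i))%:R / (N * N)%:R.

Let N0R : 0 < N%:R :> R. Proof. by rewrite ltr0n. Qed.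
Let m0 : (0 < N * N)%N. Proof. by rewrite muln_gt0 N0. Qed.
Let m0R : 0 < (N * N)%:R :> R. Proof. by rewrite ltr0n. Qed.

Let level_value_ge0 (j : nat) : (j <= N * N)%N -> 0 <= 1 - j%:R / (N * N)%:R :> R.
Proof. by move=> jm; rewrite subr_ge0 ler_pdivrMr// mul1r ler_nat. Qed.

Let gap_profile_bounds (k : nat) (i : 'I_agent_count) : (k < N)%N ->
  0 <= gap_profile k i <= 1.
Proof.
move=> kN; rewrite level_value_ge0 ?displaced_max ?agent_level_max//=.
by rewrite gerBl divr_ge0.
Qed.

Lemma profile_gap_profile (k : nat) : (k < N)%N -> profile (gap_profile k).
Proof. by move=> kN i; have /andP[] := gap_profile_bounds i kN. Qed.

Let agent0 : 'I_agent_count := ord0.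
Let one_lt_agent_count : (1 < agent_count)%N.
Proof. by rewrite /agent_count ltnS expn_gt0 (ltnW base_gt1). Qed.
Let agent1 : 'I_agent_count := Ordinal one_lt_agent_count.

Let agent01 : agent0 != agent1. Proof. by []. Qed.

Let displaced0 (k : nat) : displaced k 0 = 0%N.
Proof. by rewrite /displaced ltn0. Qed.

Let gap_profile0 (k : nat) : gap_profile k agent0 = 1.
Proof. by rewrite /gap_profile agent_level0 displaced0 mul0r subr0. Qed.

Let gap_profile1 (k : nat) : gap_profile k agent1 = 1.
Proof. by rewrite /gap_profile agent_level1 displaced0 mul0r subr0. Qed.

(* [J] is the lowest level whose value is tied with the top value 1; only if [J]
   lies in the [k]-th block does the lottery run by [Opt F] exploit the gap. *)
Lemma residual_surplus_gap_profile_le (F : cont_dist R) : exists J : nat,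
  forall k, (k < N)%N -> residual_surplus (Opt F agent_count) (gap_profile k) <=
    2 / (N * N)%:R + ((J %/ N)%N == k)%:R / N%:R.
Proof.
pose tied j := (ironed_virtual_value F 1 <=
  ironed_virtual_value F (1 - j%:R / (N * N)%:R))%E.
have tied0 : exists j, (j <= N * N)%N && tied j.
  by exists 0%N; rewrite /tied mul0r subr0 lexx.
have tied_max j : (j <= N * N)%N && tied j -> (j <= N * N)%N by case/andP.
case: (ex_maxnP tied0 tied_max) => J /andP[Jm tJ] Jmax.
have tiedE j : (j <= N * N)%N -> tied j = (j <= J)%N.
  move=> jm; apply/idP/idP => [tj|jJ]; first by apply: Jmax; rewrite jm.
  apply: (le_trans tJ); apply: ironed_virtual_value_nondecreasing.
    exact: level_value_ge0.
  by rewrite lerD2l lerN2 ler_pM2r ?invr_gt0// ler_nat.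
(* [J'] is the worst level among the winners once block [k] has been emptied. *)
exists J => k kN; pose J' := if (J %/ N)%N == k then (k * N)%N else J.
have J'J : (J' <= J)%N by rewrite /J'; case: eqP => // <-; exact: leq_trunc_div.
have J'm := leq_trans J'J Jm.
set v := gap_profile k; set W := winners F v.
have WE : W = [set i : 'I_agent_count | (agent_level i <= J')%N]%SET.
  rewrite /W (winnersE F (fun i => gap_profile_bounds i kN) (gap_profile0 k)).
  apply/setP => i; rewrite !inE -[LHS]/(tied _) tiedE ?displaced_max//.
    exact: displaced_le.
  exact: agent_level_max.
(* The first grid value below the tied ones, or 0 when the whole grid is tied. *)
pose b : R := 1 - (minn J.+1 (N * N))%:R / (N * N)%:R.
have b0 : 0 <= b by rewrite level_value_ge0// geq_minr.
have bP : b = 0 \/ ~~ (ironed_virtual_value F 1 <= ironed_virtual_value F b)%E.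
  have [Jlt|mJ] := ltnP J (N * N); [right|left].
    by rewrite /b -/(tied _) (minn_idPl Jlt) tiedE// ltnn.
  by rewrite /b (minn_idPr _) ?(leq_trans mJ)// divff ?subrr// gt_eqF.
have := @residual_surplus_Opt_le _ F _ v 1 agent0 agent1
  (fun i => gap_profile_bounds i kN) agent01 (gap_profile0 k) (gap_profile1 k) b b0 bP.
move=> /le_trans; apply; rewrite -/W.
have W0 : 0 < #|W|%:R :> R.
  by rewrite ltr0n; apply/card_gt0P; exists agent0; rewrite WE inE agent_level0.
(* A bound on the distance from the value of level [J'] down to [b]: one grid step, plus the gap
   when [J] lies in block [k]. *)
pose d : R := 1 / (N * N)%:R + ((J %/ N)%N == k)%:R / N%:R.
have bE : 1 - b <= J.+1%:R / (N * N)%:R.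
  by rewrite /b opprB addrC subrK ler_pM2r ?invr_gt0// ler_nat geq_minl.
have Jd : J.+1%:R / (N * N)%:R - J'%:R / (N * N)%:R <= d.
  rewrite -mulrBl /d /J'; case: eqP => [Jk|_]; last first.
    by rewrite mul0r addr0 ler_pM2r ?invr_gt0// -natr1 addrAC subrr add0r.
  have : (J < k * N + N)%N by rewrite -Jk -mulSnr -ltn_divLR.
  rewrite -ltnS -(ltr_nat R) => JN.
  have -> : 1 / (N * N)%:R + true%:R / N%:R = (1 + N%:R) / (N * N)%:R :> R.
    by rewrite natrM -[true%:R]/(1 : R); field; rewrite gt_eqF.
  rewrite ler_pM2r ?invr_gt0// lerBlDr; apply: (le_trans (ltW JN)).
  by rewrite -[leLHS]natr1 natrD; lra.
(* Winners at level [J'] gain at most [d]; for the rare better ones the crude bound 1 suffices. *)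
have vb i : i \in W -> v i - b <= (agent_level i < J')%:R + d.
  rewrite WE inE leq_eqVlt => /predU1P[iJ|iJ].
    rewrite iJ ltnn add0r /v /gap_profile iJ.
    have -> : displaced k J' = J'.
      rewrite /displaced /J'; case: (boolP (J %/ N == k)%N) => [_|Jk].
        by rewrite ltnn.
      rewrite ifF//; apply/negP => /andP[kJ Jk1]; case/negP: Jk.
      by rewrite eqn_leq -ltnS ltn_divLR// leq_divRL// Jk1 ltnW.
    by move: bE Jd; lra.
  rewrite iJ; have d0 : 0 <= d by rewrite addr_ge0// divr_ge0.
  have /andP[_ vi1] := gap_profile_bounds i kN.
  apply: (@le_trans _ _ 1); last by rewrite lerDl.
  by apply: le_trans vi1; rewrite gerBl.
apply: (@le_trans _ _ (#|W|%:R^-1 * \sum_(i in W) ((agent_level i < J')%:R + d))).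
  by rewrite ler_pM2l ?invr_gt0//; exact: ler_sum.
rewrite ler_pdivrMl// big_split/= sumr_const -[d *+ _]mulr_natl.
have low : \sum_(i in W) (agent_level i < J')%:R <= #|W|%:R / (N * N)%:R :> R.
  rewrite ler_pdivlMr//.
  have -> : \sum_(i in W) (agent_level i < J')%:R =
      #|[set i : 'I_agent_count | (agent_level i < J')%N]%SET|%:R :> R.
    rewrite -sum1dep_card natr_sum big_mkcond [RHS]big_mkcond/=.
    apply: eq_bigr => i _; rewrite WE inE; case: ltnP => iJ.
      by rewrite (ltnW iJ).
    by case: ifP.
  by rewrite -natrM ler_nat WE; exact: card_agent_level_lt.
apply: (le_trans (lerD low (lexx _))); rewrite /d.
by rewrite le_eqVlt; apply/orP; left; apply/eqP; ring.
Qed.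

Lemma residual_surplus_gap_profile_ge (k : nat) : (k < N)%N ->
  exists F : cont_dist R,
    1 / (2 * N%:R) <= residual_surplus (Opt F agent_count) (gap_profile k).
Proof.
(* The threshold sits in the middle of the gap between [1 - (k + 1) / N] and [1 - k / N], so winners
   clear it by half the gap, [1 / (2 * N)]. *)
move=> kN; pose a : R := 1 - (k%:R + 1 / 2) / N%:R.
have kNR : k%:R + 1 <= N%:R :> R by rewrite natr1 ler_nat.
have k0 : 0 <= k%:R :> R by [].
have a01 : 0 < a <= 1.
  have k2 : 0 <= k%:R + 1 / 2 :> R by lra.
  rewrite /a; apply/andP; split; last by rewrite gerBl divr_ge0// ltW.
  by rewrite subr_gt0 ltr_pdivrMr// mul1r; lra.
have /andP[a0 a1] := a01.
exists (two_step a01).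
have a1' : a < 1 by rewrite /a gtrBl divr_gt0//; lra.
have top2 : ironed_virtual_value (two_step a01) 1 = 2%:E.
  by apply: two_step_ironed_high; rewrite a1'/=; lra.
have vb i := gap_profile_bounds i kN.
apply: (@le_residual_surplus_Opt _ _ _ _ 1 agent0 agent1 vb agent01
  (gap_profile0 k) (gap_profile1 k) a _ (ltW a0)).
- move=> z /andP[az z1]; rewrite top2 two_step_ironed_high// az/=.
  by apply: (le_lt_trans z1); lra.
- move=> i; rewrite (winnersE (two_step a01) vb (gap_profile0 k)).
  rewrite inE top2 => iW.
  have mE : (N * N)%:R = N%:R * N%:R :> R by rewrite natrM.
  have [jk|kj] := leqP (displaced k (agent_level i)) (k * N).
    rewrite /gap_profile; set j := displaced _ _ in jk *.
    have : j%:R / (N * N)%:R <= k%:R / N%:R :> R.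
      rewrite mE ler_pdivrMr ?mulr_gt0//.
      have -> : k%:R / N%:R * (N%:R * N%:R) = (k * N)%:R :> R.
        by rewrite natrM; field; rewrite gt_eqF.
      by rewrite ler_nat.
    have -> : a + 1 / (2 * N%:R) = 1 - k%:R / N%:R.
      by rewrite /a; field; rewrite gt_eqF.
    by lra.
  (* An agent not above the gap is below it, hence under the threshold, and loses. *)
  have {}kj : (k.+1 * N <= displaced k (agent_level i))%N.
    by move: kj; rewrite /displaced; case: ifPn => //; lia.
  have : gap_profile k i < a.
    rewrite /gap_profile /a ltrD2l ltrN2; set j := displaced _ _ in kj *.
    apply: (@lt_le_trans _ _ (k.+1%:R / N%:R)).
      by rewrite ltr_pM2r ?invr_gt0// -[k.+1%:R]natr1; lra.
    rewrite mE ler_pdivlMr ?mulr_gt0//.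
    have -> : k.+1%:R / N%:R * (N%:R * N%:R) = (k.+1 * N)%:R :> R.
      by rewrite natrM; field; rewrite gt_eqF.
    by rewrite ler_nat.
  move=> va; have /andP[vi0 _] := gap_profile_bounds i kN.
  have := @two_step_ironed_low _ _ a01 (gap_profile k i).
  by rewrite vi0 va => /(_ isT); rewrite ltNge iW.
- by rewrite divr_ge0// mulr_ge0.
Qed.

(** The level [J] depends on [F] only, so at most one block contains it: the sum is at most
    [N * (2 / N ^ 2) + 1 / N]. *)
Lemma sum_residual_surplus_gap_profile_le (F : cont_dist R) :
  \sum_(k < N) residual_surplus (Opt F agent_count) (gap_profile k) <= 3 / N%:R.
Proof.
have [J HJ] := residual_surplus_gap_profile_le F.
apply: (@le_trans _ _ (\sum_(k < N) (2 / (N * N)%:R + ((J %/ N)%N == k)%:R / N%:R))).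
  by apply: ler_sum => k _; exact: HJ.
rewrite big_split/= sumr_const card_ord -[_ *+ N]mulr_natl -mulr_suml.
have le1 : \sum_(k < N) ((J %/ N)%N == k)%:R <= 1 :> R.
  have [JN|NJ] := ltnP (J %/ N)%N N.
    rewrite (bigD1 (Ordinal JN))//= eqxx big1 ?addr0// => k kJ.
    by case: eqP => // Jk; case/eqP: kJ; exact: val_inj.
  by rewrite big1// => k _; case: eqP => // Jk; move: (ltn_ord k); rewrite -Jk ltnNge NJ.
have /(ler_wpM2r (_ : 0 <= N%:R^-1)) := le1.
rewrite invr_ge0 ltW// => /(_ isT) H.
have -> : N%:R * (2 / (N * N)%:R) = 2 / N%:R :> R.
  by rewrite natrM; field; rewrite gt_eqF.
by move: H; rewrite mul1r; lra.
Qed.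

(** Summed over the [N] profiles, the mixture earns at most [3 / N], as each of its auctions does.
    Adoption would require at least [1 / (2 * rho * N)] on each profile, hence [N <= 6 * rho]. *)
Lemma not_universally_adopted_gap_profile (rho : R) (M : auction_mixture R agent_count) :
  0 < rho -> 6 * rho < N%:R -> ~ universally_adopted rho M.
Proof.
move=> rho0 rhoN UA.
pose S (k : 'I_N) (w : mix_space M) :=
  residual_surplus (Opt (mix_dist w) agent_count) (gap_profile k).
have lower (k : 'I_N) :
    ((rho^-1 * (1 / (2 * N%:R)))%:E <= \int[mix_prob M]_w (S k w)%:E)%E.
  apply: (@le_trans _ _ ((rho^-1)%:E * benchmark (gap_profile k))%E); last first.
    by apply: UA; exact: profile_gap_profile.
  rewrite EFinM; apply: lee_wpmul2l; first by rewrite lee_fin invr_ge0 ltW.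
  have [F HF] := residual_surplus_gap_profile_ge (ltn_ord k).
  apply: (@le_trans _ _ (residual_surplus (Opt F agent_count) (gap_profile k))%:E).
    by rewrite lee_fin.
  by apply: ereal_sup_ubound; exists F.
have mS k : measurable_fun setT (fun w => (S k w)%:E).
  by apply/measurable_EFinP; apply: mix_measurable; exact: profile_gap_profile.
have S0 k w : (0 <= (S k w)%:E)%E by rewrite lee_fin residual_surplus_ge0.
have upper : (\sum_(k < N) \int[mix_prob M]_w (S k w)%:E <= (3 / N%:R)%:E)%E.
  rewrite -ge0_integral_sum//.
  apply: (@le_trans _ _ (\int[mix_prob M]_w (cst (3 / N%:R)%:E) w)%E).
    apply: ge0_le_integral => //.
    - by move=> w _; apply: sume_ge0.
    - exact: emeasurable_sum.
    - by move=> w _; rewrite sumEFin lee_fin; exact: sum_residual_surplus_gap_profile_le.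
  by rewrite integral_cst//= probability_setT mule1.
have : (\sum_(k < N) (rho^-1 * (1 / (2 * N%:R)))%:E <= (3 / N%:R)%:E)%E.
  by apply: le_trans upper; apply: lee_sum => k _; exact: lower.
rewrite sumEFin lee_fin sumr_const card_ord -[_ *+ N]mulr_natl ler_pdivlMr//.
have -> : N%:R * (rho^-1 * (1 / (2 * N%:R))) * N%:R = N%:R / (2 * rho) :> R.
  by field; rewrite !gt_eqF.
by rewrite ler_pdivrMr ?mulr_gt0//; lra.
Qed.

End gap_profile.

Theorem theorem5p6 (R : realType) (rho : R) (hrho : 1 < rho) :
  exists n : nat, forall M : auction_mixture R n, ~ universally_adopted rho M.
Proof.
have rho0 : 0 < rho by apply: lt_trans hrho.
have rhoN := archi_boundP (mulr_ge0 (ler0n R 6) (ltW rho0)).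
set N := Num.bound _ in rhoN.
have N0 : (0 < N)%N by rewrite -(ltr_nat R); apply: lt_trans rhoN; rewrite mulr_gt0.
exists (agent_count N) => M.
exact: not_universally_adopted_gap_profile rhoN.
Qed.
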